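(* In the Kac-Moody 2-supercategory $\mathfrak U(\mathfrak g)$, for all $i\in I$ and $\lambda\in P$ the following relations hold: $$(E_i\varepsilon'_i)\circ(\eta'_iE_i)=(-1)^{|i,\lambda|}\,E_i1_\lambda,\qquad (\varepsilon'_iF_i)\circ(F_i\eta'_i)=F_i1_\lambda ,$$ where in the first relation the right-hand region is $\lambda$ (so it is an identity in $\mathrm{End}(E_i1_\lambda)$) and the second is an identity in $\mathrm{End}(F_i1_\lambda)$.
   Context: **Super conventions.** $\Bbbk=\Bbbk_{\bar0}\oplus\Bbbk_{\bar1}$ is a fixed supercommutative ground ring; $|x|\in\mathbb Z/2$ denotes parity. A superspace is a $\mathbb Z/2$-graded $(\Bbbk,\Bbbk)$-bimodule with $cv=(-1)^{|c||v|}vc$. A (strict) 2-supercategory consists of objects, 1-morphisms $F:\lambda\to\mu$ (composed strictly associatively and unitally, $GF$ meaning first $F$), and superspaces of 2-morphisms $F\Rightarrow F'$, with bilinear, parity-preserving, associative, unital vertical composition $\circ$ and horizontal composition (written by juxtaposition) satisfying the super interchange law $(vu)\circ(yx)=(-1)^{|u||y|}(v\circ y)(u\circ x)$. The same symbol denotes a 1-morphism and its identity 2-morphism; thus $(yH)\circ(Gx)=yx=(-1)^{|x||y|}(Kx)\circ(yF)$ for $x:F\to H$, $y:G\to K$. **Data.** $I$ is a set with parity function $i\mapsto|i|\in\mathbb Z/2$ ($2$ is invertible in $\Bbbk$ if $I$ has odd elements). $(-d_{ij})_{i,j\in I}$ is a generalized Cartan matrix: $d_{ii}=-2$, $d_{ij}\in\mathbb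 Z_{\ge0}$ for $i\ne j$, $d_{ij}=0\Leftrightarrow d_{ji}=0$; moreover $|i|=\bar1\Rightarrow d_{ij}$ is even. $\mathfrak h$ is a complex vector space with linearly independent $\{\alpha_i\}\subset\mathfrak h^*$, $\{h_i\}\subset\mathfrak h$, $\langle h_i,\alpha_j\rangle=-d_{ij}$; $P=\{\lambda\in\mathfrak h^*:\langle h_i,\lambda\rangle\in\mathbb Z\ \forall i\}$, $Q=\bigoplus_i\mathbb Z\alpha_i$; $\mathfrak g$ is the associated Kac-Moody algebra. Fix units $t_{ij}\in\Bbbk_{\bar0}^\times$ with $t_{ii}=1$ and $t_{ij}=t_{ji}$ if $d_{ij}=0$, and $s_{ij}^{pq}\in\Bbbk_{\bar0}$ ($0<p<d_{ij}$, $0<q<d_{ji}$) with $s_{ij}^{pq}=s_{ji}^{qp}$ and $s_{ij}^{pq}=0$ if $p|i|=\bar1$. **Kac-Moody 2-supercategory $\mathfrak U(\mathfrak g)$.** Objects: $P$. Generating 1-morphisms: $E_i1_\lambda:\lambda\to\lambda+\alpha_i$, $F_i1_\lambda:\lambda\to\lambda-\alpha_i$. Generating 2-morphisms, for all $\lambda$ (suppressed from notation): $x_i:E_i\to E_i$ of parity $|i|$, $\tau_{ij}:E_iE_j\to E_jE_i$ of parity $|i||j|$, $\eta_i:1_\lambda\to F_iE_i1_\lambda$ and $\varepsilon_i:E_iF_i1_\lambda\to1_\lambda$, both even. Powers $x_i^n$ are vertical powers. Relations: (R1) $\tau_{ji}\circ\tau_{ij}=0$ if $i=j$; $=t_{ij}E_iE_j$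 if $d_{ij}=0$; otherwise $=t_{ij}x_i^{d_{ij}}E_j+t_{ji}E_ix_j^{d_{ji}}+\sum_{0<p<d_{ij},0<q<d_{ji}}s_{ij}^{pq}x_i^px_j^q$. (R2) $\tau_{ij}\circ(x_iE_j)-(-1)^{|i||j|}(E_jx_i)\circ\tau_{ij}=(x_jE_i)\circ\tau_{ij}-(-1)^{|i||j|}\tau_{ij}\circ(E_ix_j)=\delta_{i,j}E_iE_j$. (R3) $(\tau_{jk}E_i)\circ(E_j\tau_{ik})\circ(\tau_{ij}E_k)-(E_k\tau_{ij})\circ(\tau_{ik}E_j)\circ(E_i\tau_{jk})$ equals $\sum_{r+s=d_{ij}-1}(-1)^{|i|(|j|+s)}t_{ij}\,x_i^rE_jx_i^s+\sum_{0<p<d_{ij},0<q<d_{ji},\,r+s=p-1}(-1)^{|i|(|j|+s)}s_{ij}^{pq}\,x_i^rx_j^qx_i^s$ ($r,s\ge0$) if $i=k\ne j$, and $0$ otherwise. (R4) $(\varepsilon_iE_i)\circ(E_i\eta_i)=E_i$, $(F_i\varepsilon_i)\circ(\eta_iF_i)=F_i$. (R5) Put $\sigma_{ji}:=(F_iE_j\varepsilon_i)\circ(F_i\tau_{ij}F_i)\circ(\eta_iE_jF_i):E_jF_i1_\lambda\to F_iE_j1_\lambda$. Then the following are required to be isomorphisms (in the additive envelope), i.e. the matrix entries of two-sided inverses are adjoined as further generating 2-morphisms: $\sigma_{ji}$ for $i\ne j$; with $h=\langle h_i,\lambda\rangle$, the column $M$ with entries $\sigma_{ii}$ and $\varepsilon_i\circ(x_i^nF_i)$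 ($0\le n<h$): $E_iF_i1_\lambda\to F_iE_i1_\lambda\oplus1_\lambda^{\oplus h}$ if $h\ge0$; the row $M$ with entries $\sigma_{ii}$ and $(F_ix_i^n)\circ\eta_i$ ($0\le n<-h$): $E_iF_i1_\lambda\oplus1_\lambda^{\oplus -h}\to F_iE_i1_\lambda$ if $h\le0$. **Leftward morphisms.** Fix units $c_{\lambda;i}\in\Bbbk_{\bar0}^\times$ with $c_{\lambda+\alpha_j;i}=t_{ij}c_{\lambda;i}$. $|i,\lambda|:=|i|(\langle h_i,\lambda\rangle+1)$. Leftward crossing $\tau'_{ij}:F_iE_j1_\lambda\to E_jF_i1_\lambda$: $\tau'_{ij}:=\sigma_{ji}^{-1}$ if $i\neq j$, while $-\tau'_{ii}$ is the component $F_iE_i1_\lambda\to E_iF_i1_\lambda$ of $M^{-1}$. If $h=\langle h_i,\lambda\rangle>0$, let $\delta_n:1_\lambda\to E_iF_i1_\lambda$ ($0\le n<h$) be the other components of $M^{-1}$; if $h<0$, let $\gamma_n:F_iE_i1_\lambda\to1_\lambda$ ($0\le n<-h$) be the other components of $M^{-1}$. Then, of parity $|i,\lambda|$: $\eta'_i:1_\lambda\to E_iF_i1_\lambda$ is $c_{\lambda;i}\delta_{h-1}$ if $h>0$ and $(-1)^{|i,\lambda|}c_{\lambda;i}\,\tau'_{ii}\circ(F_ix_i^{-h})\circ\eta_i$ if $h\le0$; $\varepsilon'_i:F_iE_i1_\lambda\to1_\lambda$ is $c_{\lambda;i}^{-1}\gamma_{-h-1}$ if $h<0$ and $-(-1)^{|i|h}c_{\lambda;i}^{-1}\,\varepsilon_i\circ(x_i^hF_i)\circ\tau'_{ii}$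 if $h\ge0$. *)

(* Defs.v *)
From mathcomp Require Import all_boot all_order all_algebra.
From mathcomp Require Import complex.
From mathcomp Require Import boolp reals.

Set Implicit Arguments.
Unset Strict Implicit.
Unset Printing Implicit Defensive.

Import Order.TTheory GRing.Theory Num.Theory.
Local Open Scope ring_scope.

(* Parities in Z/2 are booleans: true is odd, addition is (+), product is &&. *)

Record superRing := SuperRing {
  sr_ring :> unitRingType;
  hpart : bool -> sr_ring -> Prop;
  hpart0 : forall p, hpart p 0;
  hpartB : forall p a b, hpart p a -> hpart p b -> hpart p (a - b);
  hpart1 : hpart false 1;
  hpartM : forall p q a b, hpart p a -> hpart q b -> hpart (p (+) q) (a * b);
  hpart_sum : forall a, exists a0 a1,
    [/\ hpart false a0, hpart true a1 & a = a0 + a1];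
  hpart_direct : forall a, hpart false a -> hpart true a -> a = 0;
  hpart_comm : forall p q a b, hpart p a -> hpart q b ->
    a * b = (-1) ^+ (p && q) * (b * a)
}.

(* The index set may be infinite and the space hh infinite dimensional, so
   linear independence is stated for finite subfamilies. *)
Record cartan_datum (R : realType) (I : eqType) := CartanDatum {
  par : I -> bool;
  d : I -> I -> int;
  d_diag : forall i, d i i = -2;
  d_ge0 : forall i j, i != j -> 0 <= d i j;
  d_eq0 : forall i j, d i j = 0 <-> d j i = 0;
  d_even : forall i j, par i -> ~~ odd `|d i j|%N;
  hh : lmodType R[i];
  root : I -> {scalar hh};
  coroot : I -> hh;
  root_free : forall (r : seq I) (a : I -> R[i]), uniq r ->
    (forall v, \sum_(i <- r) a i * root i v = 0) ->
    forall i, i \in r -> a i = 0;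
  coroot_free : forall (r : seq I) (a : I -> R[i]), uniq r ->
    \sum_(i <- r) a i *: coroot i = 0 -> forall i, i \in r -> a i = 0;
  root_coroot : forall i j, root j (coroot i) = - (d i j)%:~R
}.

Section Weights.
Variables (R : realType) (I : eqType) (D : cartan_datum R I).

(* The weight lattice P. *)
Record weight := Weight {
  wfun :> {scalar hh D};
  wint : forall i, exists z : int, wfun (coroot D i) == z%:~R
}.

(* The integer <h_i, la>. *)
Definition pairing (i : I) (la : weight) : int := xchoose (wint la i).

Lemma pairingE i (la : weight) : la (coroot D i) = (pairing i la)%:~R.
Proof. exact/eqP/(xchooseP (wint la i)). Qed.

Lemma addw_int (la : weight) j i : exists z : int,
  (wfun la \+ root D j) (coroot D i) == z%:~R.
Proof.
exists (pairing i la - d D i j).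
by rewrite /= pairingE root_coroot -intrN -intrD.
Qed.

Lemma subw_int (la : weight) j i : exists z : int,
  (wfun la \- root D j) (coroot D i) == z%:~R.
Proof.
exists (pairing i la + d D i j).
by rewrite /= pairingE root_coroot opprK -intrD.
Qed.

(* la + alpha_j and la - alpha_j *)
Definition addw (la : weight) (j : I) : weight := Weight (addw_int la j).
Definition subw (la : weight) (j : I) : weight := Weight (subw_int la j).

Lemma scalar_ext (V : lmodType R[i]) (f g : {scalar V}) : f =1 g -> f = g.
Proof.
case: f g => [f1 [[a] [b]]] [f2 [[a'] [b']]] /= /funext h; subst f2.
by rewrite (Prop_irrelevance a' a) (Prop_irrelevance b' b).
Qed.

Lemma weight_ext (la mu : weight) : wfun la =1 wfun mu -> la = mu.
Proof.
case: la mu => f hf [g hg] /= /scalar_ext fg; subst g.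
by rewrite (Prop_irrelevance hg hf).
Qed.

Lemma addwK la j : subw (addw la j) j = la.
Proof. by apply: weight_ext => v /=; rewrite addrK. Qed.

Lemma subwK la j : addw (subw la j) j = la.
Proof. by apply: weight_ext => v /=; rewrite subrK. Qed.

Lemma addwC la i j : addw (addw la i) j = addw (addw la j) i.
Proof. by apply: weight_ext => v /=; rewrite addrAC. Qed.

(* A 1-morphism with source la is a word in the letters E_i, F_i whose
   rightmost letter acts first; its target is tgt la w. *)
Inductive letter := E of I | F of I.
Definition word := seq letter.

Definition step (g : letter) (mu : weight) : weight :=
  match g with E i => addw mu i | F i => subw mu i end.

Definition tgt (la : weight) (w : word) : weight := foldr step la w.

Lemma tgt_cat la v w : tgt la (v ++ w) = tgt (tgt la w) v.
Proof. by rewrite /tgt foldr_cat. Qed.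

End Weights.

Arguments E {I} i.
Arguments F {I} i.

(* Even units of K are the units of its even part: the inverse of an even unit
   is even. *)
Record km_params (K : superRing) (R : realType) (I : eqType)
    (D : cartan_datum R I) := KMParams {
  two_unit : forall i, par D i -> (2 : K) \is a GRing.unit;
  tc : I -> I -> K;
  tc_even : forall i j, hpart false (tc i j);
  tc_unit : forall i j, tc i j \is a GRing.unit;
  tc_diag : forall i, tc i i = 1;
  tc_sym : forall i j, d D i j = 0 -> tc i j = tc j i;
  sc : I -> I -> nat -> nat -> K;
  sc_even : forall i j (p q : nat),
    (0 < p%:Z < d D i j) -> (0 < q%:Z < d D j i) -> hpart false (sc i j p q);
  sc_sym : forall i j (p q : nat),
    (0 < p%:Z < d D i j) -> (0 < q%:Z < d D j i) -> sc i j p q = sc j i q p;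
  sc_odd : forall i j (p q : nat),
    (0 < p%:Z < d D i j) -> (0 < q%:Z < d D j i) ->
    odd p && par D i -> sc i j p q = 0
}.

Record km_units (K : superRing) (R : realType) (I : eqType)
    (D : cartan_datum R I) (Q : km_params K D) := KMUnits {
  cu : weight D -> I -> K;
  cu_even : forall la i, hpart false (cu la i);
  cu_unit : forall la i, cu la i \is a GRing.unit;
  cu_add : forall la i j, cu (addw la j) i = tc Q i j * cu la i
}.

Definition natpos (z : int) : nat := if z is Posz n then n else 0%N.

Lemma natpos_last (z : int) : 0 < z -> ((natpos z).-1 < natpos z)%N.
Proof. by case: z => [[|n]|n]. Qed.

Declare Scope tm_scope.
Delimit Scope tm_scope with tm.

Section Terms.
Variables (K : superRing) (R : realType) (I : eqType) (D : cartan_datum R I).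

(* Expressions for 2-morphisms v 1_la => w 1_la. The generators tinv, tdelta,
   tgamma are the entries of the adjoined inverses: tinv i j goes with the
   (i, j) crossing (for i = j it is the F_i E_i -> E_i F_i entry), and
   tdelta, tgamma are indexed by 0 <= n < h and 0 <= n < - h respectively,
   where h = <h_i, la>. *)
Inductive tm (la : weight D) : word I -> word I -> Type :=
| tid w : tm la w w
| tvc u v w : tm la v w -> tm la u v -> tm la u w
| thc v w v' w' : tm (tgt la v) v' w' -> tm la v w -> tm la (v' ++ v) (w' ++ w)
| tzero v w : tgt la v = tgt la w -> tm la v w
| tadd v w : tm la v w -> tm la v w -> tm la v w
| tscale v w : K -> tm la v w -> tm la v w
| tx i : tm la [:: E i] [:: E i]
| ttau i j : tm la [:: E i; E j] [:: E j; E i]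
| teta i : tm la [::] [:: F i; E i]
| teps i : tm la [:: E i; F i] [::]
| tinv i j : tm la [:: F i; E j] [:: E j; F i]
| tdelta i (n : 'I_(natpos (pairing i la))) : tm la [::] [:: E i; F i]
| tgamma i (n : 'I_(natpos (- pairing i la))) : tm la [:: F i; E i] [::].

Lemma parallel la v w : tm la v w -> tgt la v = tgt la w.
Proof.
elim=> {v w la} //=; rewrite ?tgt_cat //=.
- by move=> la u v w _ -> _ ->.
- by move=> la v w v' w' _ IH1 _ IH2; rewrite !tgt_cat IH1 IH2.
- by move=> la i j; rewrite addwC.
- by move=> la i; rewrite addwK.
- by move=> la i; rewrite subwK.
- move=> la i j; apply: weight_ext => x /=; exact: addrAC.
- by move=> la i _; rewrite subwK.
- by move=> la i _; rewrite addwK.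
Qed.

(* Transport along equalities of the source object and of 1-morphisms, needed
   since horizontal composition is strictly associative and unital only up to
   the provable equalities catA, cats0 and tgt_cat. *)
Definition cast la la' v v' w w' (el : la = la') (ev : v = v') (ew : w = w')
    (f : tm la v w) : tm la' v' w' :=
  match el in _ = l, ev in _ = a, ew in _ = b return tm l a b with
  | erefl, erefl, erefl => f
  end.

End Terms.

Arguments tid {K R I D la} w.
Arguments tvc {K R I D la u v w} f%_tm g%_tm.
Arguments thc {K R I D la v w v' w'} f%_tm g%_tm.
Arguments tzero {K R I D la v w} e.
Arguments tadd {K R I D la v w} f%_tm g%_tm.
Arguments tscale {K R I D la v w} a%_R f%_tm.
Arguments tx {K R I D la} i.
Arguments ttau {K R I D la} i j.
Arguments teta {K R I D la} i.
Arguments teps {K R I D la} i.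
Arguments tinv {K R I D la} i j.
Arguments tdelta {K R I D la i} n.
Arguments tgamma {K R I D la i} n.

Bind Scope tm_scope with tm.

Reserved Notation "f ∘ g" (at level 38, right associativity).
Reserved Notation "f ⊗ g" (at level 35, right associativity).

(* vertical and horizontal composition *)
Notation "f ∘ g" := (tvc f g) : tm_scope.
Notation "f ⊗ g" := (thc f g) : tm_scope.
Notation "f + g" := (tadd f g) : tm_scope.
Notation "a *: f" := (tscale a f) : tm_scope.
Notation "f - g" := (tadd f (tscale (-1) g)) : tm_scope.

Section Relations.
Variables (K : superRing) (R : realType) (I : eqType) (D : cartan_datum R I).
Variable Q : km_params K D.
Local Notation tm := (@tm K R I D).
Local Notation pr := (par D).
Local Notation sgn p := ((-1) ^+ (nat_of_bool p) : K).
Local Notation dn i j := (`|d D i j|%N).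
Local Open Scope tm_scope.

(* Homogeneous expressions and their parity. *)
Inductive homog :
  forall la : weight D, forall v w, bool -> tm la v w -> Prop :=
| homog_id la w : homog false (tid w : tm la w w)
| homog_vc la u v w p q (f : tm la v w) (g : tm la u v) :
    homog p f -> homog q g -> homog (p (+) q) (f ∘ g)
| homog_hc la v w v' w' p q (f : tm (tgt la v) v' w') (g : tm la v w) :
    homog p f -> homog q g -> homog (p (+) q) (f ⊗ g)
| homog_zero la v w p (e : tgt la v = tgt la w) : homog p (tzero e : tm la v w)
| homog_add la v w p (f g : tm la v w) :
    homog p f -> homog p g -> homog p (f + g)
| homog_scale la v w p q (a : K) (f : tm la v w) :
    hpart p a -> homog q f -> homog (p (+) q) (a *: f)
| homog_x la i : homog (pr i) (tx i : tm la _ _)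
| homog_tau la i j : homog (pr i && pr j) (ttau i j : tm la _ _)
| homog_eta la i : homog false (teta i : tm la _ _)
| homog_eps la i : homog false (teps i : tm la _ _)
| homog_inv la i j : homog (pr i && pr j) (tinv i j : tm la _ _)
| homog_delta la i (n : 'I_(natpos (pairing i la))) :
    homog (pr i && odd n) (tdelta n)
| homog_gamma la i (n : 'I_(natpos (- pairing i la))) :
    homog (pr i && odd n) (tgamma n).

Definition tsum (A : Type) la w (r : seq A) (f : A -> tm la w w) : tm la w w :=
  foldr (fun a g => f a + g) (tzero erefl) r.

Definition xpow la i (n : nat) : tm la [:: E i] [:: E i] :=
  iter n (fun f => tx i ∘ f) (tid [:: E i]).
Arguments xpow {la} i n.

(* The rightward crossing E_j F_i => F_i E_j. *)
Definition sigma la j i : tm la [:: E j; F i] [:: F i; E j] :=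
  (tid [:: F i; E j] ⊗ teps i) ∘ (tid [:: F i] ⊗ ttau i j ⊗ tid [:: F i])
  ∘ (teta i ⊗ tid [:: E j; F i]).
Arguments sigma {la} j i.

Definition dotcap la i (n : nat) : tm la [:: E i; F i] [::] :=
  teps i ∘ (xpow i n ⊗ tid [:: F i]).
Arguments dotcap {la} i n.

Definition dotcup la i (n : nat) : tm la [::] [:: F i; E i] :=
  (tid [:: F i] ⊗ xpow i n) ∘ teta i.
Arguments dotcup {la} i n.

(* The defining relations. Right-hand sides given by a Kronecker delta, or
   depending on whether indices coincide, are split into cases. In the sums
   over r + s = m - 1 the index is s. *)
Inductive km_rel : forall la v w, tm la v w -> tm la v w -> Prop :=
| quad_same la i : km_rel (la := la) (ttau i i ∘ ttau i i) (tzero erefl)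
| quad_orth la i j : d D i j = 0 ->
    km_rel (la := la) (ttau j i ∘ ttau i j) (tc Q i j *: tid [:: E i; E j])
| quad_gen la i j : i != j -> d D i j != 0 ->
    km_rel (la := la) (ttau j i ∘ ttau i j)
      (tc Q i j *: (xpow i (dn i j) ⊗ tid [:: E j])
       + tc Q j i *: (tid [:: E i] ⊗ xpow j (dn j i))
       + tsum (iota 1 (dn i j).-1) (fun p => tsum (iota 1 (dn j i).-1) (fun q =>
           sc Q i j p q *: (xpow i p ⊗ xpow j q))))

| dotl_same la i :
    km_rel (la := la)
      (ttau i i ∘ (tx i ⊗ tid [:: E i])
       - sgn (pr i && pr i) *: ((tid [:: E i] ⊗ tx i) ∘ ttau i i))
      (tid [:: E i; E i])
| dotl_diff la i j e : i != j ->
    km_rel (la := la)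
      (ttau i j ∘ (tx i ⊗ tid [:: E j])
       - sgn (pr i && pr j) *: ((tid [:: E j] ⊗ tx i) ∘ ttau i j))
      (tzero e)
| dotr_same la i :
    km_rel (la := la)
      ((tx i ⊗ tid [:: E i]) ∘ ttau i i
       - sgn (pr i && pr i) *: (ttau i i ∘ (tid [:: E i] ⊗ tx i)))
      (tid [:: E i; E i])
| dotr_diff la i j e : i != j ->
    km_rel (la := la)
      ((tx j ⊗ tid [:: E i]) ∘ ttau i j
       - sgn (pr i && pr j) *: (ttau i j ∘ (tid [:: E i] ⊗ tx j)))
      (tzero e)

| braid_same la i j : i != j ->
    km_rel (la := la)
      ((ttau j i ⊗ tid [:: E i]) ∘ (tid [:: E j] ⊗ ttau i i)
         ∘ (ttau i j ⊗ tid [:: E i])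
       - (tid [:: E i] ⊗ ttau i j) ∘ (ttau i i ⊗ tid [:: E j])
         ∘ (tid [:: E i] ⊗ ttau j i))
      (tsum (iota 0 (dn i j)) (fun s =>
         (sgn (pr i && (pr j (+) odd s)) * tc Q i j)
           *: (xpow i ((dn i j).-1 - s) ⊗ tid [:: E j] ⊗ xpow i s))
       + tsum (iota 1 (dn i j).-1) (fun p => tsum (iota 1 (dn j i).-1) (fun q =>
         tsum (iota 0 p) (fun s =>
           (sgn (pr i && (pr j (+) odd s)) * sc Q i j p q)
             *: (xpow i (p.-1 - s) ⊗ xpow j q ⊗ xpow i s)))))
| braid_diff la i j k e : ~~ ((i == k) && (i != j)) ->
    km_rel (la := la)
      ((ttau j k ⊗ tid [:: E i]) ∘ (tid [:: E j] ⊗ ttau i k)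
         ∘ (ttau i j ⊗ tid [:: E k])
       - (tid [:: E k] ⊗ ttau i j) ∘ (ttau i k ⊗ tid [:: E j])
         ∘ (tid [:: E i] ⊗ ttau j k))
      (tzero e)

| zigzagE la i :
    km_rel (la := la)
      ((teps i ⊗ tid [:: E i]) ∘ (tid [:: E i] ⊗ teta i)) (tid [:: E i])
| zigzagF la i :
    km_rel (la := la)
      ((tid [:: F i] ⊗ teps i) ∘ (teta i ⊗ tid [:: F i])) (tid [:: F i])

| inv_diff_r la i j : i != j ->
    km_rel (la := la) (sigma j i ∘ tinv i j) (tid [:: F i; E j])
| inv_diff_l la i j : i != j ->
    km_rel (la := la) (tinv i j ∘ sigma j i) (tid [:: E j; F i])

| inv_pos_ss la i : 0 <= pairing i la ->
    km_rel (la := la) (sigma i i ∘ tinv i i) (tid [:: F i; E i])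
| inv_pos_sd la i (n : 'I_(natpos (pairing i la))) e : 0 <= pairing i la ->
    km_rel (la := la) (sigma i i ∘ tdelta n) (tzero e)
| inv_pos_ds la i (m : 'I_(natpos (pairing i la))) e : 0 <= pairing i la ->
    km_rel (la := la) (dotcap i m ∘ tinv i i) (tzero e)
| inv_pos_dd la i (m n : 'I_(natpos (pairing i la))) : 0 <= pairing i la ->
    km_rel (la := la) (dotcap i m ∘ tdelta n) ((m == n)%:R *: tid [::])
| inv_pos_l la i : 0 <= pairing i la ->
    km_rel (la := la)
      (tinv i i ∘ sigma i i
       + tsum (enum 'I_(natpos (pairing i la))) (fun n => tdelta n ∘ dotcap i n))
      (tid [:: E i; F i])

| inv_neg_ss la i : pairing i la <= 0 ->
    km_rel (la := la) (tinv i i ∘ sigma i i) (tid [:: E i; F i])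
| inv_neg_sd la i (n : 'I_(natpos (- pairing i la))) e : pairing i la <= 0 ->
    km_rel (la := la) (tinv i i ∘ dotcup i n) (tzero e)
| inv_neg_ds la i (m : 'I_(natpos (- pairing i la))) e : pairing i la <= 0 ->
    km_rel (la := la) (tgamma m ∘ sigma i i) (tzero e)
| inv_neg_dd la i (m n : 'I_(natpos (- pairing i la))) : pairing i la <= 0 ->
    km_rel (la := la) (tgamma m ∘ dotcup i n) ((m == n)%:R *: tid [::])
| inv_neg_r la i : pairing i la <= 0 ->
    km_rel (la := la)
      (sigma i i ∘ tinv i i
       + tsum (enum 'I_(natpos (- pairing i la)))
           (fun n => dotcup i n ∘ tgamma n))
      (tid [:: F i; E i]).

(* Equality of 2-morphisms: the congruence generated by km_rel and the axioms of a
   strict 2-supercategory. The 2-morphisms of the Kac-Moody 2-supercategory are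
   the expressions in tm modulo eqv. Only the left action of K is primitive; the
   right one is f a = (-1)^(|a||f|) a f, whence the signs in eqv_vcZr and
   eqv_hcZr. *)
Inductive eqv : forall la v w, tm la v w -> tm la v w -> Prop :=
| eqv_rel la v w (f g : tm la v w) : km_rel f g -> eqv f g
| eqv_refl la v w (f : tm la v w) : eqv f f
| eqv_sym la v w (f g : tm la v w) : eqv f g -> eqv g f
| eqv_trans la v w (f g h : tm la v w) : eqv f g -> eqv g h -> eqv f h
| eqv_vc la u v w (f f' : tm la v w) (g g' : tm la u v) :
    eqv f f' -> eqv g g' -> eqv (f ∘ g) (f' ∘ g')
| eqv_hc la v w v' w' (f f' : tm (tgt la v) v' w') (g g' : tm la v w) :
    eqv f f' -> eqv g g' -> eqv (f ⊗ g) (f' ⊗ g')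
| eqv_add la v w (f f' g g' : tm la v w) :
    eqv f f' -> eqv g g' -> eqv (f + g) (f' + g')
| eqv_scale la v w a (f f' : tm la v w) : eqv f f' -> eqv (a *: f) (a *: f')

| eqv_addA la v w (f g h : tm la v w) : eqv (f + (g + h)) ((f + g) + h)
| eqv_addC la v w (f g : tm la v w) : eqv (f + g) (g + f)
| eqv_add0 la v w e (f : tm la v w) : eqv (tzero e + f) f
| eqv_addN la v w e (f : tm la v w) : eqv (f - f) (tzero e)
| eqv_scaleA la v w a b (f : tm la v w) : eqv (a *: (b *: f)) ((a * b) *: f)
| eqv_scale1 la v w (f : tm la v w) : eqv (1 *: f) f
| eqv_scaleDl la v w a b (f : tm la v w) :
    eqv ((a + b)%R *: f) (a *: f + b *: f)
| eqv_scaleDr la v w a (f g : tm la v w) :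
    eqv (a *: (f + g)) (a *: f + a *: g)

| eqv_vcA la u v w z (f : tm la w z) (g : tm la v w) (h : tm la u v) :
    eqv (f ∘ (g ∘ h)) ((f ∘ g) ∘ h)
| eqv_vc1l la v w (f : tm la v w) : eqv (tid w ∘ f) f
| eqv_vc1r la v w (f : tm la v w) : eqv (f ∘ tid v) f
| eqv_vcDl la u v w (f f' : tm la v w) (g : tm la u v) :
    eqv ((f + f') ∘ g) (f ∘ g + f' ∘ g)
| eqv_vcDr la u v w (f : tm la v w) (g g' : tm la u v) :
    eqv (f ∘ (g + g')) (f ∘ g + f ∘ g')
| eqv_vcZl la u v w a (f : tm la v w) (g : tm la u v) :
    eqv ((a *: f) ∘ g) (a *: (f ∘ g))
| eqv_vcZr la u v w p q a (f : tm la v w) (g : tm la u v) :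
    hpart p a -> homog q f ->
    eqv (f ∘ (a *: g)) ((sgn (p && q) * a) *: (f ∘ g))

| eqv_hcA la v w v' w' v'' w'' (f : tm (tgt (tgt la v) v') v'' w'')
    (g : tm (tgt la v) v' w') (h : tm la v w) el ev ew :
    eqv (cast el erefl erefl f ⊗ (g ⊗ h)) (cast erefl ev ew ((f ⊗ g) ⊗ h))
| eqv_hc1l la v w (f : tm la v w) : eqv (tid [::] ⊗ f) f
| eqv_hc1r la v w (f : tm (tgt la [::]) v w) ev ew :
    eqv (cast erefl ev ew (f ⊗ (tid [::] : tm la _ _))) f
| eqv_hc_id la v v' :
    eqv ((tid v' : tm (tgt la v) _ _) ⊗ (tid v : tm la _ _)) (tid (v' ++ v))
| eqv_hcDl la v w v' w' (f f' : tm (tgt la v) v' w') (g : tm la v w) :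
    eqv ((f + f') ⊗ g) (f ⊗ g + f' ⊗ g)
| eqv_hcDr la v w v' w' (f : tm (tgt la v) v' w') (g g' : tm la v w) :
    eqv (f ⊗ (g + g')) (f ⊗ g + f ⊗ g')
| eqv_hcZl la v w v' w' a (f : tm (tgt la v) v' w') (g : tm la v w) :
    eqv ((a *: f) ⊗ g) (a *: (f ⊗ g))
| eqv_hcZr la v w v' w' p q a (f : tm (tgt la v) v' w') (g : tm la v w) :
    hpart p a -> homog q f ->
    eqv (f ⊗ (a *: g)) ((sgn (p && q) * a) *: (f ⊗ g))
| eqv_interchange la v0 v1 v2 w0 w1 w2 p q (x : tm la v0 v1) (u : tm la v1 v2)
    (y : tm (tgt la v0) w0 w1) (v : tm (tgt la v0) w1 w2) el :
    homog p u -> homog q y ->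
    eqv ((cast el erefl erefl v ⊗ u) ∘ (y ⊗ x))
      (sgn (p && q) *: ((v ∘ y) ⊗ (u ∘ x))).

Variable N : km_units Q.

(* The leftward crossing F_i E_j => E_j F_i. *)
Definition taul la i j : tm la [:: F i; E j] [:: E j; F i] :=
  if i == j then (-1) *: tinv i j else tinv i j.
Arguments taul {la} i j.

(* The parity |i,la|. *)
Definition par_at (i : I) (la : weight D) : bool :=
  pr i && odd `|(pairing i la + 1)%R|%N.

Definition etal la i : tm la [::] [:: E i; F i] :=
  match @idP (0 < pairing i la) with
  | ReflectT h_gt0 => cu N la i *: tdelta (Ordinal (natpos_last h_gt0))
  | ReflectF _ =>
      (sgn (par_at i la) * cu N la i)
        *: (taul i i ∘ dotcup i `|pairing i la|%N)
  end.

Definition epsl la i : tm la [:: F i; E i] [::] :=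
  match @idP (0 < - pairing i la) with
  | ReflectT h_lt0 => (cu N la i)^-1 *: tgamma (Ordinal (natpos_last h_lt0))
  | ReflectF _ =>
      (- (sgn (pr i && odd `|pairing i la|%N) * (cu N la i)^-1))
        *: (dotcap i `|pairing i la|%N ∘ taul i i)
  end.

End Relations.

Arguments tsum {K R I D A la w} r f%_tm.
Arguments xpow {K R I D la} i n%_N.
Arguments sigma {K R I D la} j i.
Arguments dotcap {K R I D la} i n%_N.
Arguments dotcup {K R I D la} i n%_N.
Arguments taul {K R I D la} i j.
Arguments etal {K R I D Q} N {la} i.
Arguments epsl {K R I D Q} N {la} i.
Arguments par_at {R I D} i la.

(* Main.v *)
(* Only strands coloured i occur. Write h = <h_i, la>, eps_m = eps (x^m F), and
   suppose h >= 0. For Y = (E tau') (delta_(h+1) E) : E -> EEF the first zigzag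
   is, up to signs and units, (E eps_h) Y. The entries of the columns M of (R5)
   at la and la + alpha_i are jointly injective on EEF and on EFE, and they
   satisfy (eps E) (E sigma) = (E eps) (tau F) and
   (sigma E) (E sigma) (tau F) = (F tau) (sigma E) (E sigma). Testing (tau F) Y
   against these entries, with tau^2 = 0 and the dot slides, gives
   (tau F) Y = 0. Now (E eps) (tau F) (x^(h+1) E F) Y is a sign, by the choice
   of delta_(h+1), whereas moving the dots through the crossing leaves only
   (E eps_h) Y, up to a sign; this determines (E eps_h) Y.
   For h <= -2 the same argument runs in the opposite category, and h = -1 is a
   variant without dots. The second zigzag is obtained in the same way from the
   downward dot and crossing, the mates of x and tau under (eta, eps). *)

From HB Require Import structures.
Require Import Defs.
From mathcomp Require Import all_boot all_order all_algebra.
From mathcomp Require Import complex.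
From mathcomp Require Import boolp reals.
From mathcomp Require Import generic_quotient zify.

Set Implicit Arguments.
Unset Strict Implicit.
Unset Printing Implicit Defensive.

Import Order.TTheory GRing.Theory Num.Theory.
Local Open Scope ring_scope.

Reserved Notation "f ⊙ g" (at level 38, right associativity).

(** For [h >= 0] the indices are fixed by a count of vanishing ranges. [E eps_m] kills [Y] for
    [m < h], [eps_m E] kills [delta_(h+1) E] for [m < h + 1], and tests on EFE run over [m < h + 2].
    Each dot slide leaves one correction term; after t slides it carries t dots on the second
    strand, so for [Y] it vanishes when t < h. For [(tau F) Y] the vanishing extends to t = h, by
    comparison with [delta_(h+1)], which is exactly what slides of h + 1 dots require. Strands can
    be bent only by [(eta, eps)]: the other adjunction is what is being proved. Hence the second
    zigzag is not obtained by rotating the first and needs its own downward generators. The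
    computation involves only additive maps, so it is done once for abstract abelian groups and
    applied by post- or precomposition. Two features of [tm] stand in the way: a zero exists only
    between words with equal targets, and horizontal composition is strict only up to transport. The
    first is met by a formal zero, the second by adding strands letter by letter on the left and as
    one word on the right. *)

Section Signs.
Implicit Types (U V : zmodType) (b c : bool).

(** Signs act by negation rather than by scalars: every additive map commutes with negation, whereas
    a scalar may change sign when it passes an odd morphism. *)
Definition sg V b (x : V) : V := if b then - x else x.

Lemma sg_sg V b c (x : V) : sg b (sg c x) = sg (b (+) c) x.
Proof. by case: b c => [] [] //=; rewrite opprK. Qed.

Lemma sg0 V b : sg b 0 = 0 :> V.
Proof. by case: b; rewrite //= oppr0. Qed.

Lemma sgD V b (x y : V) : sg b (x + y) = sg b x + sg b y.
Proof. by case: b; rewrite //= opprD. Qed.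

Lemma sg_inj V b : injective (@sg V b).
Proof. by case: b => x y //= /oppr_inj. Qed.

Lemma sg_eq0 V b (x : V) : sg b x = 0 -> x = 0.
Proof. by move=> bx; apply: (@sg_inj _ b); rewrite bx sg0. Qed.

Lemma raddf_sg U V (f : {additive U -> V}) b x : f (sg b x) = sg b (f x).
Proof. by case: b; rewrite //= raddfN. Qed.

End Signs.

(* V0, .., V3 stand for Hom(X0, Xj), or for Hom(Xj, X0), where (X0, .., X3) is
   (E, EEF, EFE, FEE) or one of its mirror images; T is composition with the
   crossing of X1, C and C' with the caps to X0, A, B and A' with dots, S1 and
   S2 with sigma. *)
Section ZigzagAlgebra.
Variables (V0 V1 V2 V3 : zmodType) (p e : bool).
Variables (a : {additive V0 -> V0}) (T A B : {additive V1 -> V1}).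
Variables (A' : {additive V2 -> V2}) (T' : {additive V3 -> V3}).
Variables (C : {additive V1 -> V0}) (C' : {additive V2 -> V0}).
Variables (S1 : {additive V1 -> V2}) (S2 : {additive V2 -> V3}).

Hypothesis TT : forall z, T (T z) = 0.
Hypothesis CS : forall z, C' (S1 z) = C (T z).
Hypothesis SST : forall z, S2 (S1 (T z)) = T' (S2 (S1 z)).

Section Dots.
Hypothesis TA : forall z, T (A z) = sg p (B (T z)) + sg e z.
Hypothesis CA : forall z, C (A z) = a (C z).
Hypothesis BA : forall z, B (A z) = sg p (A (B z)).
Hypothesis AS : forall z, A' (S1 z) = sg p (S1 (A z)).

Lemma iterS_dot m z : iter m A' (S1 z) = sg (p && odd m) (S1 (iter m A z)).
Proof.
elim: m => [|m IH] /=; first by rewrite andbF.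
by rewrite IH raddf_sg AS sg_sg; case: p (odd m) => [] [].
Qed.

Lemma capS_dot m z :
  C' (iter m A' (S1 z)) = sg (p && odd m) (C (T (iter m A z))).
Proof. by rewrite iterS_dot raddf_sg CS. Qed.

Lemma cap_swap j m z : C (iter j B z) = 0 -> C (iter j B (iter m A z)) = 0.
Proof.
have BiA k x : iter k B (A x) = sg (p && odd k) (A (iter k B x)).
  elim: k => [|k IH] /=; first by rewrite andbF.
  by rewrite IH raddf_sg BA sg_sg; case: p (odd k) => [] [].
move=> Cz; elim: m => [|m IH] //=.
by rewrite BiA raddf_sg CA IH raddf0 sg0.
Qed.

(* The hypothesis kills the correction terms of the j dot slides. *)
Lemma cap_cross j m z : (forall t, (t < j)%N -> C (iter t B z) = 0) ->
  C (T (iter (j + m) A z)) = sg (p && odd j) (C (iter j B (T (iter m A z)))).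
Proof.
elim: j m => [|j IH] m Cz; first by rewrite andbF.
rewrite addSnnS IH => [|t lt_tj]; last exact/Cz/ltnW.
have iterD x y : iter j B (x + y) = iter j B x + iter j B y.
  by elim: {IH Cz} j => //= k ->; rewrite raddfD.
have itersg b x : iter j B (sg b x) = sg b (iter j B x).
  by elim: {IH Cz iterD} j => //= k ->; rewrite raddf_sg.
rewrite /= TA iterD !itersg raddfD !raddf_sg cap_swap ?Cz //.
rewrite sg0 addr0 sg_sg -iterS iterSr /=.
by case: p (odd j) => [] [].
Qed.

Variables (h : nat) (b : bool) (one : V0) (Dl : V2) (Y : V1).
Hypothesis inj1 : forall z, S1 z = 0 ->
  (forall m, (m < h)%N -> C (iter m B z) = 0) -> z = 0.
Hypothesis inj2 : forall z, S2 z = 0 ->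
  (forall m, (m < h.+2)%N -> C' (iter m A' z) = 0) -> z = 0.
Hypothesis S1Y : S1 Y = - Dl.
Hypothesis CY : forall m, (m < h)%N -> C (iter m B Y) = 0.
Hypothesis S2D : S2 Dl = 0.
Hypothesis CD0 : forall m, (m < h.+1)%N -> C' (iter m A' Dl) = 0.
Hypothesis CD1 : C' (iter h.+1 A' Dl) = sg b one.

(** This links the unknown [Y] to the known entry [Dl]: by [capS_dot] a crossing under the cap is
    the same as [S1] under the other cap, and [S1 Y = - Dl]. *)
Lemma cap_crossY m : C (T (iter m A Y)) =
  sg (p && odd m) (- C' (iter m A' Dl)).
Proof.
have iterN z : iter m A' (- z) = - iter m A' z.
  by elim: m => //= k ->; rewrite raddfN.
apply: (@sg_inj _ (p && odd m)).
by rewrite -capS_dot S1Y iterN raddfN sg_sg addbb.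
Qed.

Lemma cross_zero : T Y = 0.
Proof.
(* [inj1] asks only for [m < h]. The extra value [m = h] serves the slides below, where up to
   [h + 1] dots are moved past the crossing of [T Y]. *)
have CTY m : (m < h.+1)%N -> C (iter m B (T Y)) = 0.
  move=> lt_mh; apply: (@sg_inj _ (p && odd m)).
  rewrite -(@cap_cross m 0) ?addn0 => [|t lt_tm]; last first.
    by apply: CY; exact: leq_trans lt_tm _.
  by rewrite cap_crossY CD0 // oppr0 !sg0.
apply: inj1 => [|m lt_mh]; last exact/CTY/ltnW.
apply: inj2 => [|m lt_mh]; first by rewrite SST S1Y !raddfN S2D raddf0 oppr0.
(* The slide is applied to [T Y] instead of [Y], which brings two crossings together. *)
rewrite capS_dot -[m]addn0 (@cap_cross m 0) => [|t lt_tm]; last first.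
  by apply: CTY; exact: leq_trans lt_tm _.
rewrite /= TT.
have -> : iter m B 0 = 0 by elim: m {lt_mh} => //= k ->; rewrite raddf0.
by rewrite raddf0 !sg0.
Qed.

Lemma zigzag_dots : C (iter h B Y) = sg (~~ p (+) e (+) b) one.
Proof.
(* Only [h] of the [h + 1] dots are moved by [cap_cross]. The last one is moved by [TA]: its main
   term contains [T Y = 0], and its correction term is [Y] itself. *)
have := cap_crossY h.+1; rewrite CD1 -addn1 cap_cross // addn1 /= TA.
rewrite cross_zero raddf0 sg0 add0r.
have itersg x : iter h B (sg e x) = sg e (iter h B x).
  by elim: h => //= k ->; rewrite raddf_sg.
rewrite itersg raddf_sg sg_sg => eqCY.
apply: (@sg_inj _ (p && odd h (+) e)); rewrite eqCY -[- _]/(sg true _) !sg_sg.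
by case: p e b (odd h) => [] [] [] [].
Qed.

End Dots.

Variables (U : {additive V0 -> V2}) (V : {additive V0 -> V3}).
Variables (one g : V0) (Dl : V2) (Y : V1).
Hypothesis TT' : forall z, T' (T' z) = 0.
Hypothesis inj1 : forall z, S1 z = 0 -> z = 0.
Hypothesis inj2 : forall z, S2 z = 0 -> C' z = 0 -> z = 0.
Hypothesis CU : forall z, C' (U z) = z.
Hypothesis SU : forall z, S2 (U z) = T' (V z).
Hypothesis S1Y : S1 Y = - Dl + U g.
Hypothesis S2D : S2 Dl = 0.
Hypothesis CD : C' Dl = one.

(* The case h = -1: no dots are involved. *)
Lemma zigzag_nodots : g = one.
Proof.
(* The summand [U g] of [S1 Y] disappears as well: [S2 U = T' V], and [SST] supplies a second
   [T']. *)
have TY : T Y = 0.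
  apply: inj1; apply: inj2; last by rewrite CS TT raddf0.
  by rewrite SST S1Y raddfD raddfN S2D oppr0 add0r SU TT'.
have := CS Y; rewrite TY raddf0 S1Y raddfD raddfN CD CU => /eqP.
by rewrite addrC subr_eq0 => /eqP.
Qed.

End ZigzagAlgebra.

(** * 2-morphisms modulo eqv *)

Section Calculus.
Local Open Scope quotient_scope.
Variables (K : superRing) (R : realType) (I : eqType) (D : cartan_datum R I).
Variable Q : km_params K D.
Local Notation tm := (@tm K R I D).
Local Notation eqv := (@eqv K R I D Q _ _ _).
Implicit Types (la mu : weight D) (u v w : word I).

(* [None] is a formal zero, available also between words with distinct
   targets, where [tm] is empty. *)
Definition otm la v w := option (tm la v w).
HB.instance Definition _ la v w := gen_eqMixin (otm la v w).
HB.instance Definition _ la v w := gen_choiceMixin (otm la v w).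

Definition oval la v w (e : tgt la v = tgt la w) (f : otm la v w) : tm la v w :=
  if f is Some t then t else tzero e.

(** If the targets of [v] and [w] differ, the condition is vacuous and [None] is the only element;
    if they agree, [None] is identified with [tzero]. *)
Definition oeqv la v w (f g : otm la v w) : bool :=
  `[< forall e, eqv (oval e f) (oval e g) >].

Lemma oeqv_refl la v w : reflexive (@oeqv la v w).
Proof. by move=> f; apply/asboolP => e; apply: eqv_refl. Qed.

Lemma oeqv_sym la v w : symmetric (@oeqv la v w).
Proof.
by move=> f g; apply/asboolP/asboolP => fg e; apply/eqv_sym/fg.
Qed.

Lemma oeqv_trans la v w : transitive (@oeqv la v w).
Proof.
move=> g f h /asboolP fg /asboolP gh; apply/asboolP => e.
exact: eqv_trans (fg e) (gh e).
Qed.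

Canonical oeqv_equiv la v w :=
  EquivRel (@oeqv la v w) (@oeqv_refl _ _ _) (@oeqv_sym _ _ _)
    (@oeqv_trans _ _ _).

Definition mor la v w := {eq_quot @oeqv la v w}.
HB.instance Definition _ la v w := Choice.on (mor la v w).

Definition pim la v w (f : otm la v w) : mor la v w := \pi_(mor la v w) f.

Lemma repr_pim la v w (f : mor la v w) : pim (repr f) = f.
Proof. exact: reprK. Qed.

Definition cls la v w (f : tm la v w) : mor la v w := pim (Some f).

Lemma oclsP la v w (f g : otm la v w) :
  (forall e, eqv (oval e f) (oval e g)) ->
  pim f = pim g.
Proof. by move=> fg; apply/eqmodP/asboolP. Qed.

Lemma oclsE la v w (f g : otm la v w) e :
  pim f = pim g -> eqv (oval e f) (oval e g).
Proof. by move/eqmodP/asboolP => fg; apply: fg. Qed.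

Lemma clsP la v w (f g : tm la v w) : cls f = cls g <-> eqv f g.
Proof.
by split=> [/(oclsE (parallel f))|fg] //; apply: oclsP.
Qed.

Lemma tzero_irr la v w (e e' : tgt la v = tgt la w) :
  tzero e = tzero e' :> tm la v w.
Proof. by rewrite (Prop_irrelevance e e'). Qed.

(** The rules for zero in composites come from here: additivity and [0 + 0 = 0] show that such a
    composite equals its own double. *)
Lemma eqv_add_cancel la v w (f : tm la v w) e :
  eqv (f + f)%tm f -> eqv f (tzero e).
Proof.
move=> ff; apply: eqv_trans _ (eqv_addN Q e f).
apply: eqv_sym; apply: eqv_trans (eqv_add (eqv_sym ff) (eqv_refl _ _)) _.
apply: eqv_trans (eqv_sym (eqv_addA _ _ _ _)) _.
apply: eqv_trans (eqv_add (eqv_refl _ _) (eqv_addN Q e f)) _.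
apply: eqv_trans (eqv_addC _ _ _) _; exact: eqv_add0.
Qed.

Lemma eqv_00 la v w (e : tgt la v = tgt la w) :
  eqv (tzero e + tzero e)%tm (tzero e).
Proof. exact: eqv_add0. Qed.

Lemma eqv_0vc la u v w (e : tgt la v = tgt la w) e' (g : tm la u v) :
  eqv (tvc (tzero e) g) (tzero e').
Proof.
apply: eqv_add_cancel; apply: eqv_trans (eqv_sym (eqv_vcDl _ _ _ _)) _.
by apply: eqv_vc (eqv_00 _) (eqv_refl _ _).
Qed.

Lemma eqv_vc0 la u v w (e : tgt la u = tgt la v) e' (f : tm la v w) :
  eqv (tvc f (tzero e)) (tzero e').
Proof.
apply: eqv_add_cancel; apply: eqv_trans (eqv_sym (eqv_vcDr _ _ _ _)) _.
by apply: eqv_vc (eqv_refl _ _) (eqv_00 _).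
Qed.

Lemma eqv_0hc la v w v' w' e e' (g : tm la v w) :
  eqv (thc (tzero e : tm _ v' w') g) (tzero e').
Proof.
apply: eqv_add_cancel; apply: eqv_trans (eqv_sym (eqv_hcDl _ _ _ _)) _.
by apply: eqv_hc (eqv_00 _) (eqv_refl _ _).
Qed.

Lemma eqv_hc0 la v w v' w' e e' (f : tm (tgt la v) v' w') :
  eqv (thc f (tzero e : tm la v w)) (tzero e').
Proof.
apply: eqv_add_cancel; apply: eqv_trans (eqv_sym (eqv_hcDr _ _ _ _)) _.
by apply: eqv_hc (eqv_refl _ _) (eqv_00 _).
Qed.

Lemma eqv_sc0 la v w a e e' :
  eqv (a *: (tzero e : tm la v w))%tm (tzero e').
Proof.
apply: eqv_add_cancel; apply: eqv_trans (eqv_sym (eqv_scaleDr _ _ _ _)) _.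
by apply: eqv_scale (eqv_00 _).
Qed.

(** * Operations on classes and the abelian group structure *)

Definition oadd la v w (f g : otm la v w) : otm la v w :=
  match f, g with
  | Some f, Some g => Some (f + g)%tm | None, _ => g | _, None => f
  end.
Definition oscl a la v w (f : otm la v w) : otm la v w :=
  if f is Some f then Some (a *: f)%tm else None.
Definition ocomp la u v w (f : otm la v w) (g : otm la u v) : otm la u w :=
  if (f, g) is (Some f, Some g) then Some (tvc f g) else None.
Definition ohc la v w v' w' (f : otm (tgt la v) v' w') (g : otm la v w) :
    otm la (v' ++ v) (w' ++ w) :=
  if (f, g) is (Some f, Some g) then Some (thc f g) else None.

Definition madd la v w (f g : mor la v w) : mor la v w :=
  pim (oadd (repr f) (repr g)).
Definition scl a la v w (f : mor la v w) : mor la v w := pim (oscl a (repr f)).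
Definition mcomp la u v w (f : mor la v w) (g : mor la u v) : mor la u w :=
  pim (ocomp (repr f) (repr g)).
Definition hc la v w v' w' (f : mor (tgt la v) v' w') (g : mor la v w) :
    mor la (v' ++ v) (w' ++ w) :=
  pim (ohc (repr f) (repr g)).

Lemma oval_add la v w e (f g : otm la v w) :
  eqv (oval e (oadd f g)) (oval e f + oval e g)%tm.
Proof.
case: f g => [f|] [g|] /=.
- exact: eqv_refl.
- by apply: eqv_sym; apply: eqv_trans (eqv_addC _ _ _) _; apply: eqv_add0.
- by apply: eqv_sym; apply: eqv_add0.
- by apply: eqv_sym; apply: eqv_add0.
Qed.

Lemma maddE la v w (f g : otm la v w) :
  madd (pim f) (pim g) = pim (oadd f g).
Proof.
rewrite /madd; apply: oclsP => e; apply: eqv_trans (oval_add _ _ _) _.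
apply: eqv_trans (eqv_sym (oval_add _ _ _)).
by apply: eqv_add; apply: oclsE; rewrite repr_pim.
Qed.

Lemma oval_scl a la v w e (f : otm la v w) :
  eqv (oval e (oscl a f)) (a *: oval e f)%tm.
Proof.
case: f => [f|] /=; first exact: eqv_refl.
by apply: eqv_sym; apply: eqv_sc0.
Qed.

Lemma sclE a la v w (f : otm la v w) : scl a (pim f) = pim (oscl a f).
Proof.
rewrite /scl; apply: oclsP => e; apply: eqv_trans (oval_scl _ _ _) _.
apply: eqv_trans (eqv_sym (oval_scl _ _ _)).
by apply: eqv_scale; apply: oclsE; rewrite repr_pim.
Qed.

Lemma ocls_ind la v w (P : mor la v w -> Prop) :
  (forall f : tm la v w, P (cls f)) -> P (pim None) -> forall f, P f.
Proof. by move=> PS P0 f; rewrite -[f]repr_pim; case: (repr f). Qed.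

Lemma ocls_zero la v w e : cls (tzero e : tm la v w) = pim None.
Proof. by apply: oclsP => e' /=; rewrite (tzero_irr e e'); apply: eqv_refl. Qed.

Lemma maddA la v w : associative (@madd la v w).
Proof.
move=> f g h; rewrite -[f]repr_pim -[g]repr_pim -[h]repr_pim !maddE.
apply: oclsP => e.
have rw := oval_add; do 2 ?apply: eqv_trans (rw _ _ _ _ _ _) _.
apply: eqv_trans (eqv_add (eqv_refl _ _) (rw _ _ _ _ _ _)) _.
apply: eqv_trans (eqv_addA _ _ _ _) _; apply: eqv_sym.
apply: eqv_trans (rw _ _ _ _ _ _) _.
exact: eqv_add (rw _ _ _ _ _ _) (eqv_refl _ _).
Qed.

Lemma maddC la v w : commutative (@madd la v w).
Proof.
move=> f g; rewrite -[f]repr_pim -[g]repr_pim !maddE; apply: oclsP => e.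
apply: eqv_trans (oval_add _ _ _) _; apply: eqv_sym.
apply: eqv_trans (oval_add _ _ _) _; exact: eqv_addC.
Qed.

Lemma madd0 la v w : left_id (pim None) (@madd la v w).
Proof. by move=> f; rewrite -[f]repr_pim maddE. Qed.

Lemma maddN la v w : left_inverse (pim None) (@scl (-1) la v w) (@madd la v w).
Proof.
move=> f; rewrite -[f]repr_pim sclE maddE; case: (repr f) => [t|//].
apply: oclsP => e /=; apply: eqv_trans (eqv_addC _ _ _) _; exact: eqv_addN.
Qed.

HB.instance Definition _ la v w :=
  GRing.isZmodule.Build (mor la v w) (@maddA la v w) (@maddC la v w)
    (@madd0 la v w) (@maddN la v w).

Lemma cls_zero la v w e : cls (tzero e : tm la v w) = 0.
Proof. exact: ocls_zero. Qed.

Lemma cls_add la v w (f g : tm la v w) : cls (f + g)%tm = cls f + cls g.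
Proof. by rewrite [RHS]maddE. Qed.

Lemma cls_scl a la v w (f : tm la v w) : cls (a *: f)%tm = scl a (cls f).
Proof. by rewrite sclE. Qed.

Lemma sclN1 la v w (f : mor la v w) : scl (-1) f = - f.
Proof. by []. Qed.

Lemma scl1 la v w (f : mor la v w) : scl 1 f = f.
Proof.
rewrite -[f]repr_pim sclE; apply: oclsP => e.
apply: eqv_trans (oval_scl _ _ _) _; exact: eqv_scale1.
Qed.

Lemma sclDl a b la v w (f : mor la v w) : scl (a + b) f = scl a f + scl b f.
Proof.
rewrite -[f]repr_pim !sclE [RHS]maddE; apply: oclsP => e.
apply: eqv_trans (oval_scl _ _ _) _; apply: eqv_trans (eqv_scaleDl _ _ _ _) _.
apply: eqv_sym; apply: eqv_trans (oval_add _ _ _) _.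
by apply: eqv_add; apply: oval_scl.
Qed.

Lemma scl0 la v w (f : mor la v w) : scl 0 f = 0.
Proof. by apply: (addIr (scl 0 f)); rewrite -sclDl !add0r. Qed.

Lemma scl_sgn (b : bool) la v w (f : mor la v w) : scl ((-1) ^+ b) f = sg b f.
Proof. by case: b; rewrite ?sclN1 ?scl1. Qed.

Lemma oval_comp la u v w e e1 e2 (f : otm la v w) (g : otm la u v) :
  eqv (oval e (ocomp f g)) (tvc (oval e1 f) (oval e2 g)).
Proof.
case: f g => [f|] [g|] /=; first exact: eqv_refl.
all: apply: eqv_sym; first [exact: eqv_0vc | exact: eqv_vc0].
Qed.

Lemma oval_hc la v w v' w' e e1 e2 (f : otm (tgt la v) v' w') (g : otm la v w) :
  eqv (oval e (ohc f g)) (thc (oval e1 f) (oval e2 g)).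
Proof.
case: f g => [f|] [g|] /=; first exact: eqv_refl.
all: apply: eqv_sym; first [exact: eqv_0hc | exact: eqv_hc0].
Qed.

Lemma otm_none la v w (f : otm la v w) : tgt la v <> tgt la w -> f = None.
Proof. by case: f => // t /(_ (parallel t)). Qed.

Lemma compE la u v w (f : otm la v w) (g : otm la u v) :
  mcomp (pim f) (pim g) = pim (ocomp f g).
Proof.
rewrite /mcomp; apply: oclsP => e.
(* [oval_comp] needs equalities of targets for both factors. If the one for [g] fails, [g] and its
   representative are both [None], and so are the composites. *)
have [e2|ne] := pselect (tgt la u = tgt la v); last first.
  rewrite (otm_none (repr (pim g)) ne) (otm_none g ne) /ocomp.
  by case: (repr (pim f)) => [?|]; case: (f) => [?|]; apply: eqv_refl.
have e1 : tgt la v = tgt la w by rewrite -e2.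
apply: eqv_trans (oval_comp _ e1 e2 _ _) _.
apply: eqv_trans (eqv_sym (oval_comp _ e1 e2 _ _)).
by apply: eqv_vc; apply: oclsE; rewrite repr_pim.
Qed.

Lemma hcE la v w v' w' (f : otm (tgt la v) v' w') (g : otm la v w) :
  hc (pim f) (pim g) = pim (ohc f g).
Proof.
rewrite /hc; apply: oclsP => e.
have [e2|ne] := pselect (tgt la v = tgt la w); last first.
  rewrite (otm_none (repr (pim g)) ne) (otm_none g ne) /ohc.
  by case: (repr (pim f)) => [?|]; case: (f) => [?|]; apply: eqv_refl.
have e1 : tgt (tgt la v) v' = tgt (tgt la v) w'.
  by move: e; rewrite !tgt_cat -e2.
apply: eqv_trans (oval_hc _ e1 e2 _ _) _.
apply: eqv_trans (eqv_sym (oval_hc _ e1 e2 _ _)).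
by apply: eqv_hc; apply: oclsE; rewrite repr_pim.
Qed.

Local Notation "f ⊙ g" := (mcomp f g).

Definition idm la w : mor la w w := cls (tid w).

Lemma morP la v w (P : mor la v w -> Prop) :
  (forall f : tm la v w, P (cls f)) -> P 0 -> forall f, P f.
Proof. exact: ocls_ind. Qed.

Lemma cls_comp la u v w (f : tm la v w) (g : tm la u v) :
  cls (tvc f g) = cls f ⊙ cls g.
Proof. by rewrite compE. Qed.

Lemma cls_hc la v w v' w' (f : tm (tgt la v) v' w') (g : tm la v w) :
  cls (thc f g) = hc (cls f) (cls g).
Proof. by rewrite hcE. Qed.

Lemma comp0f la u v w (g : mor la u v) : (0 : mor la v w) ⊙ g = 0.
Proof. by rewrite -[g]repr_pim -[0]/(pim None) compE. Qed.

Lemma compf0 la u v w (f : mor la v w) : f ⊙ (0 : mor la u v) = 0.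
Proof.
by rewrite -[f]repr_pim -[0]/(pim None) compE /ocomp; case: (repr f).
Qed.

Lemma hc0f la v w v' w' (g : mor la v w) : hc (0 : mor _ v' w') g = 0.
Proof. by rewrite -[g]repr_pim -[0]/(pim None) hcE. Qed.

Lemma hcf0 la v w v' w' (f : mor (tgt la v) v' w') : hc f (0 : mor la v w) = 0.
Proof.
by rewrite -[f]repr_pim -[0]/(pim None) hcE /ohc; case: (repr f).
Qed.

Lemma mcompA la u v w z (f : mor la w z) (g : mor la v w) (h : mor la u v) :
  f ⊙ (g ⊙ h) = (f ⊙ g) ⊙ h.
Proof.
elim/morP: f => [f|]; last by rewrite !comp0f.
elim/morP: g => [g|]; last by rewrite !(comp0f, compf0).
elim/morP: h => [h|]; last by rewrite !compf0.
by rewrite -!cls_comp; apply/clsP/eqv_vcA.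
Qed.

Lemma comp1f la v w (f : mor la v w) : idm la w ⊙ f = f.
Proof.
elim/morP: f => [f|]; last exact: compf0.
by rewrite -cls_comp; apply/clsP/eqv_vc1l.
Qed.

Lemma compf1 la v w (f : mor la v w) : f ⊙ idm la v = f.
Proof.
elim/morP: f => [f|]; last exact: comp0f.
by rewrite -cls_comp; apply/clsP/eqv_vc1r.
Qed.

Lemma compDl la u v w (f f' : mor la v w) (g : mor la u v) :
  (f + f') ⊙ g = f ⊙ g + f' ⊙ g.
Proof.
elim/morP: f => [f|]; last by rewrite comp0f !add0r.
elim/morP: f' => [f'|]; last by rewrite comp0f !addr0.
elim/morP: g => [g|]; last by rewrite !compf0 addr0.
by rewrite -cls_add -!cls_comp -cls_add; apply/clsP/eqv_vcDl.
Qed.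

Lemma compDr la u v w (f : mor la v w) (g g' : mor la u v) :
  f ⊙ (g + g') = f ⊙ g + f ⊙ g'.
Proof.
elim/morP: g => [g|]; last by rewrite compf0 !add0r.
elim/morP: g' => [g'|]; last by rewrite compf0 !addr0.
elim/morP: f => [f|]; last by rewrite !comp0f addr0.
by rewrite -cls_add -!cls_comp -cls_add; apply/clsP/eqv_vcDr.
Qed.

Lemma hcDl la v w v' w' (f f' : mor (tgt la v) v' w') (g : mor la v w) :
  hc (f + f') g = hc f g + hc f' g.
Proof.
elim/morP: f => [f|]; last by rewrite hc0f !add0r.
elim/morP: f' => [f'|]; last by rewrite hc0f !addr0.
elim/morP: g => [g|]; last by rewrite !hcf0 addr0.
by rewrite -cls_add -!cls_hc -cls_add; apply/clsP/eqv_hcDl.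
Qed.

Lemma hcDr la v w v' w' (f : mor (tgt la v) v' w') (g g' : mor la v w) :
  hc f (g + g') = hc f g + hc f g'.
Proof.
elim/morP: g => [g|]; last by rewrite hcf0 !add0r.
elim/morP: g' => [g'|]; last by rewrite hcf0 !addr0.
elim/morP: f => [f|]; last by rewrite !hc0f addr0.
by rewrite -cls_add -!cls_hc -cls_add; apply/clsP/eqv_hcDr.
Qed.

(** * Whiskering with identity strands *)

Definition compr la u v w (g : mor la u v) (f : mor la v w) := f ⊙ g.
Definition wl la v w z (f : mor la v w) : mor la (z ++ v) (z ++ w) :=
  hc (idm (tgt la v) z) f.
Definition wr la v w z (f : mor (tgt la z) v w) : mor la (v ++ z) (w ++ z) :=
  hc f (idm la z).
Arguments wr {la v w} z f.
Arguments wl {la v w} z f.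

Lemma zmod_morphism_of (U V : zmodType) (f : U -> V) :
  {morph f : x y / x + y} -> zmod_morphism f.
Proof.
move=> fD x y; apply: (addIr (f y)).
by rewrite -fD !subrK.
Qed.

HB.instance Definition _ la u v w (f : mor la v w) :=
  GRing.isZmodMorphism.Build (mor la u v) (mor la u w) (mcomp f)
    (zmod_morphism_of (compDr f)).
HB.instance Definition _ la u v w (g : mor la u v) :=
  GRing.isZmodMorphism.Build (mor la v w) (mor la u w) (compr g)
    (zmod_morphism_of (fun f f' => compDl f f' g)).
HB.instance Definition _ la v w z :=
  GRing.isZmodMorphism.Build (mor la v w) (mor la (z ++ v) (z ++ w))
    (@wl la v w z) (zmod_morphism_of (hcDr (idm (tgt la v) z))).
HB.instance Definition _ la v w z :=
  GRing.isZmodMorphism.Build (mor (tgt la z) v w) (mor la (v ++ z) (w ++ z))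
    (@wr la v w z) (zmod_morphism_of (fun f f' => hcDl f f' (idm la z))).

Lemma comp_sgl la u v w b (f : mor la v w) (g : mor la u v) :
  sg b f ⊙ g = sg b (f ⊙ g).
Proof. exact: (raddf_sg (compr g)). Qed.

Lemma comp_sgr la u v w b (f : mor la v w) (g : mor la u v) :
  f ⊙ sg b g = sg b (f ⊙ g).
Proof. exact: (raddf_sg (mcomp f)). Qed.

Lemma compNl la u v w (f : mor la v w) (g : mor la u v) : (- f) ⊙ g = - (f ⊙ g).
Proof. exact: (raddfN (compr g)). Qed.

Lemma compNr la u v w (f : mor la v w) (g : mor la u v) : f ⊙ - g = - (f ⊙ g).
Proof. exact: (raddfN (mcomp f)). Qed.

Lemma comp_suml la u v w (J : finType) (f : J -> mor la v w) (g : mor la u v) :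
  (\sum_j f j) ⊙ g = \sum_j f j ⊙ g.
Proof. exact: (raddf_sum (compr g)). Qed.

Lemma comp_sumr la u v w (J : finType) (f : mor la v w) (g : J -> mor la u v) :
  f ⊙ (\sum_j g j) = \sum_j f ⊙ g j.
Proof. exact: (raddf_sum (mcomp f)). Qed.

Lemma wl_id la z v : wl z (idm la v) = idm la (z ++ v).
Proof. by rewrite /wl /idm -cls_hc; apply/clsP/eqv_hc_id. Qed.

Lemma wr_id la z v : wr z (idm (tgt la z) v) = idm la (v ++ z).
Proof. by rewrite /wr /idm -cls_hc; apply/clsP/eqv_hc_id. Qed.

Lemma wl0 la v w (f : mor la v w) : wl [::] f = f.
Proof.
elim/morP: f => [f|]; last by rewrite raddf0.
by rewrite /wl /idm -cls_hc; apply/clsP/eqv_hc1l.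
Qed.

Lemma cast_tid la la' (e : la = la') v :
  cast e erefl erefl (tid v : tm la v v) = tid v.
Proof. by case: _ / e. Qed.

Lemma tgt_catE la v w : tgt (tgt la w) v = tgt la (v ++ w).
Proof. by rewrite tgt_cat. Qed.

Lemma wl_cons la v w a z (f : mor la v w) :
  wl (a :: z) f = wl [:: a] (wl z f).
Proof.
elim/morP: f => [f|]; last by rewrite !raddf0.
rewrite /wl /idm -!cls_hc; apply/esym/clsP.
have := eqv_hcA Q (tid [:: a]) (tid z) f (tgt_catE _ _ _) erefl erefl.
rewrite cast_tid /= => /eqv_trans; apply.
exact: eqv_hc (eqv_hc_id Q (tgt la v) z [:: a]) (eqv_refl _ _).
Qed.

Lemma wl_wr la a v w z (f : mor (tgt la z) v w) :
  wl [:: a] (wr z f) = wr z (wl [:: a] f).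
Proof.
elim/morP: f => [f|]; last by rewrite !raddf0.
rewrite /wl /wr /idm -!cls_hc; apply/clsP.
have := eqv_hcA Q (tid [:: a]) f (tid z) (tgt_catE _ _ _) erefl erefl.
by rewrite cast_tid.
Qed.

Definition castm la la' v v' w w' (el : la = la') (ev : v = v') (ew : w = w')
    (f : mor la v w) : mor la' v' w' :=
  match el in _ = l, ev in _ = a, ew in _ = b return mor l a b with
  | erefl, erefl, erefl => f
  end.

Lemma castm_cls la la' v v' w w' (el : la = la') (ev : v = v') (ew : w = w')
    (f : tm la v w) : castm el ev ew (cls f) = cls (cast el ev ew f).
Proof. by case: _ / el; case: _ / ev; case: _ / ew. Qed.

Lemma castm0 la la' v v' w w' (el : la = la') (ev : v = v') (ew : w = w') :
  castm el ev ew 0 = 0.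
Proof. by case: _ / el; case: _ / ev; case: _ / ew. Qed.

Lemma castK la la' v w (el : la = la') (f : tm la v w) :
  cast (esym el) erefl erefl (cast el erefl erefl f) = f.
Proof. by case: _ / el. Qed.

(** Strict associativity on the right. When [u], [v] and [w] are literal words, the three equalities
    hold by computation, so the casts can be taken along [erefl]. *)
Lemma wr_cat la u v w z (f : mor (tgt la (u ++ z)) v w) el ev ew :
  wr (u ++ z) f = castm erefl ev ew (wr z (wr u (castm el erefl erefl f))).
Proof.
elim/morP: f => [f|]; last by rewrite castm0 !raddf0 castm0.
rewrite castm_cls /wr /idm -!cls_hc castm_cls; apply/clsP.
set g := cast el erefl erefl f; rewrite -[f](castK el) -/g.
apply: eqv_trans (eqv_hcA Q g (tid u) (tid z) (esym el) ev ew).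
by apply: eqv_hc (eqv_refl _ _) (eqv_sym _); apply: eqv_hc_id.
Qed.

Definition hg p la v w (f : mor la v w) :=
  exists2 t : tm la v w, homog p t & cls t = f.

Lemma hg_cls p la v w (f : tm la v w) : homog p f -> hg p (cls f).
Proof. by exists f. Qed.

Lemma hg_comp p q la u v w (f : mor la v w) (g : mor la u v) :
  hg p f -> hg q g -> hg (p (+) q) (f ⊙ g).
Proof.
move=> [s hs <-] [t ht <-]; exists (tvc s t); last by rewrite cls_comp.
exact: homog_vc.
Qed.

Lemma hg_id la w : hg false (idm la w).
Proof. by exists (tid w) => //; apply: homog_id. Qed.

Lemma hg_wl p la v w z (f : mor la v w) : hg p f -> hg p (wl z f).
Proof.
move=> [s hs <-]; exists (thc (tid z) s); last by rewrite cls_hc.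
by rewrite -[p]addFb; apply: homog_hc hs; apply: homog_id.
Qed.

Lemma hg_wr p la v w z (f : mor (tgt la z) v w) : hg p f -> hg p (wr z f).
Proof.
move=> [s hs <-]; exists (thc s (tid z)); last by rewrite cls_hc.
by rewrite -[p]addbF; apply: homog_hc hs _; apply: homog_id.
Qed.

Lemma wl_comp p la u v w z (f : mor la v w) (g : mor la u v) : hg p f ->
  wl z (f ⊙ g) = wl z f ⊙ wl z g.
Proof.
move=> [s hs <-]; elim/morP: g => [g|]; last by rewrite !(compf0, raddf0).
rewrite -cls_comp /wl /idm -!cls_hc -cls_comp; apply/esym/clsP.
have := eqv_interchange Q g (tid z) (parallel g) hs (homog_id K _ z).
rewrite cast_tid andbF expr0 => /eqv_trans; apply.
apply: eqv_trans (eqv_scale1 _ _) _.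
by apply: eqv_hc (eqv_refl _ _); apply: eqv_vc1l.
Qed.

Lemma wr_comp q la u v w z (f : mor (tgt la z) v w) (g : mor (tgt la z) u v) :
  hg q g -> wr z (f ⊙ g) = wr z f ⊙ wr z g.
Proof.
move=> [t ht <-]; elim/morP: f => [f|]; last by rewrite !(comp0f, raddf0).
rewrite -cls_comp /wr /idm -!cls_hc -cls_comp; apply/esym/clsP.
have := eqv_interchange Q (tid z) f erefl (homog_id K la z) ht.
rewrite /= expr0 => /eqv_trans; apply.
apply: eqv_trans (eqv_scale1 _ _) _.
by apply: eqv_hc (eqv_refl _ _) _; apply: eqv_vc1l.
Qed.

(* f is a family because tgt la v and tgt la v' are equal only propositionally. *)
Lemma exch p q la v v' w w' (f : forall mu, mor mu w w') (g : mor la v v') :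
  (forall mu, hg p (f mu)) -> hg q g ->
  wr v' (f (tgt la v')) ⊙ wl w g = sg (p && q) (wl w' g ⊙ wr v (f (tgt la v))).
Proof.
move=> hf [t ht <-]; have [s hs fs] := hf (tgt la v).
have e := parallel t.
have -> : f (tgt la v') = cls (cast e erefl erefl s).
  by rewrite -castm_cls fs; move: (tgt la v') e => mu e; case: _ / e.
rewrite -fs /wr /wl /idm -!cls_hc -!cls_comp.
transitivity (cls (thc s t)).
  apply/clsP.
  have := eqv_interchange Q t s e (homog_id K la v') (homog_id K _ w).
  rewrite expr0 => /eqv_trans; apply; apply: eqv_trans (eqv_scale1 _ _) _.
  by apply: eqv_hc; [apply: eqv_vc1r | apply: eqv_vc1l].
have := eqv_interchange Q (tid v) (tid w') erefl ht hs; rewrite /= => /clsP ->.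
rewrite cls_scl scl_sgn sg_sg [q && p]andbC addbb; apply/clsP/eqv_sym.
by apply: eqv_hc; [apply: eqv_vc1l | apply: eqv_vc1r].
Qed.

Arguments hg_wl {p la v w} z {f}.
Arguments hg_wr {p la v w} z {f}.
Arguments wr_comp {q la u v w} z f {g}.
Arguments wl_comp {p la u v w} z {f} g.

(* The interchange law is available for homogeneous morphisms only. *)
Class homogeneous la v w (f : mor la v w) : Prop :=
  homogeneous_ex : exists p, hg p f.

#[local] Instance hom_id la w : homogeneous (idm la w).
Proof. by exists false; apply: hg_id. Qed.

#[local] Instance hom_comp la u v w (f : mor la v w) (g : mor la u v)
  {hf : homogeneous f} {hg : homogeneous g} : homogeneous (f ⊙ g).
Proof.
by case: hf hg => [p hf] [q hq]; exists (p (+) q); apply: hg_comp.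
Qed.

(** This is [wl [:: a]] with its type stated by consing instead of concatenation, so that iterated
    whiskerings compose without transport. *)
Definition lw la v w a (f : mor la v w) : mor la (a :: v) (a :: w) :=
  wl [:: a] f.

HB.instance Definition _ la v w a :=
  GRing.isZmodMorphism.Build (mor la v w) (mor la (a :: v) (a :: w))
    (@lw la v w a) (raddfB (@wl la v w [:: a])).

#[local] Instance hom_lw la v w a (f : mor la v w) {hf : homogeneous f} :
  homogeneous (lw a f).
Proof. by case: hf => p hf; exists p; apply: (hg_wl [:: a]). Qed.

Lemma hg_lw p la v w a (f : mor la v w) : hg p f -> hg p (lw a f).
Proof. exact: (hg_wl [:: a]). Qed.

Lemma lwM la u v w a (f : mor la v w) (g : mor la u v) {hf : homogeneous f} :
  lw a (f ⊙ g) = lw a f ⊙ lw a g.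
Proof. by case: hf => p hf; apply: (wl_comp [:: a] g hf). Qed.

Lemma lw_id la v a : lw a (idm la v) = idm la (a :: v).
Proof. exact: (wl_id la [:: a]). Qed.

Lemma lw0 la v w a : lw a (0 : mor la v w) = 0.
Proof. exact: raddf0. Qed.

Lemma lw_wr la z v w a (f : mor (tgt la z) v w) :
  lw a (wr z f) = wr z (lw a f).
Proof. exact: (wl_wr a f). Qed.

Lemma lw_sum la v w a (J : finType) (f : J -> mor la v w) :
  lw a (\sum_j f j) = \sum_j lw a (f j).
Proof. exact: raddf_sum. Qed.

Lemma wrM la z u v w (f : mor (tgt la z) v w) (g : mor (tgt la z) u v)
  {hg : homogeneous g} : wr z (f ⊙ g) = wr z f ⊙ wr z g.
Proof. by case: hg => q hg; apply: (wr_comp z f hg). Qed.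

#[local] Instance hom_wr la v w z (f : mor (tgt la z) v w)
  {hf : homogeneous f} : homogeneous (wr z f).
Proof. by case: hf => q hf; exists q; apply: (hg_wr z). Qed.

Lemma wrD la z v w (f g : mor (tgt la z) v w) :
  wr z (f + g) = wr z f + wr z g.
Proof. exact: raddfD. Qed.

Lemma wr_sg la z v w b (f : mor (tgt la z) v w) :
  wr z (sg b f) = sg b (wr z f).
Proof. exact: raddf_sg. Qed.

Lemma lwD la v w a (f g : mor la v w) : lw a (f + g) = lw a f + lw a g.
Proof. exact: raddfD. Qed.

Lemma lw_sg la v w a b (f : mor la v w) : lw a (sg b f) = sg b (lw a f).
Proof. exact: raddf_sg. Qed.

Definition mpow la v m (f : mor la v v) : mor la v v :=
  iter m (mcomp f) (idm la v).

Lemma iter_mcomp la u v m (f : mor la v v) (g : mor la u v) :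
  iter m (mcomp f) g = mpow m f ⊙ g.
Proof.
elim: m => [|m IH]; first by rewrite /= /mpow comp1f.
by rewrite iterS IH mcompA.
Qed.

Lemma mpowSr la v m (f : mor la v v) : mpow m.+1 f = mpow m f ⊙ f.
Proof. by rewrite -iter_mcomp /mpow iterSr compf1. Qed.

Lemma iter_compr la u v m (f : mor la v v) (g : mor la v u) :
  iter m (compr f) g = g ⊙ mpow m f.
Proof.
elim: m => [|m IH]; first by rewrite /= /mpow compf1.
by rewrite iterS IH mpowSr mcompA.
Qed.

#[local] Instance hom_mpow la v m (f : mor la v v) {hf : homogeneous f} :
  homogeneous (mpow m f).
Proof. by rewrite /mpow; elim: m => [|m IH] /=; apply _. Qed.

Lemma lw_mpow la v a m (f : mor la v v) {hf : homogeneous f} :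
  lw a (mpow m f) = mpow m (lw a f).
Proof.
rewrite /mpow; elim: m => [|m IH]; first exact: lw_id.
by rewrite /= lwM IH.
Qed.

Lemma wr_mpow la z v m (f : mor (tgt la z) v v) {hf : homogeneous f} :
  wr z (mpow m f) = mpow m (wr z f).
Proof.
rewrite /mpow; elim: m => [|m IH]; first exact: wr_id.
have hm : homogeneous (iter m (mcomp f) (idm (tgt la z) v)) by apply: hom_mpow.
by rewrite /= wrM IH.
Qed.

(** * The abstract zigzag computation in groups of 2-morphisms *)

Section ZigzagMorphisms.
Variables (la : weight D) (w0 w1 w2 w3 : word I) (p e : bool).

Lemma zigzag_column (a : mor la w0 w0) (T A B : mor la w1 w1)
    (A' : mor la w2 w2) (T' : mor la w3 w3) (C : mor la w1 w0)
    (C' : mor la w2 w0) (S1 : mor la w1 w2) (S2 : mor la w2 w3)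
    (h : nat) (b : bool) (one : mor la w0 w0) (Dl : mor la w0 w2)
    (Y : mor la w0 w1) :
  T ⊙ T = 0 -> C' ⊙ S1 = C ⊙ T -> S2 ⊙ S1 ⊙ T = T' ⊙ S2 ⊙ S1 ->
  T ⊙ A = sg p (B ⊙ T) + sg e (idm la w1) -> C ⊙ A = a ⊙ C ->
  B ⊙ A = sg p (A ⊙ B) -> A' ⊙ S1 = sg p (S1 ⊙ A) ->
  (forall f : mor la w0 w1, S1 ⊙ f = 0 ->
     (forall m, (m < h)%N -> (C ⊙ mpow m B) ⊙ f = 0) -> f = 0) ->
  (forall f : mor la w0 w2, S2 ⊙ f = 0 ->
     (forall m, (m < h.+2)%N -> (C' ⊙ mpow m A') ⊙ f = 0) -> f = 0) ->
  S1 ⊙ Y = - Dl ->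
  (forall m, (m < h)%N -> (C ⊙ mpow m B) ⊙ Y = 0) ->
  S2 ⊙ Dl = 0 ->
  (forall m, (m < h.+1)%N -> (C' ⊙ mpow m A') ⊙ Dl = 0) ->
  (C' ⊙ mpow h.+1 A') ⊙ Dl = sg b one ->
  (C ⊙ mpow h B) ⊙ Y = sg (~~ p (+) e (+) b) one.
Proof.
move=> TT CS SST TA CA BA AS inj1 inj2 S1Y CY S2D CD0 CD1.
rewrite -mcompA -iter_mcomp.
apply: (@zigzag_dots (mor la w0 w0) (mor la w0 w1) (mor la w0 w2) (mor la w0 w3)
  p e (mcomp a) (mcomp T) (mcomp A) (mcomp B) (mcomp A') (mcomp T') (mcomp C)
  (mcomp C') (mcomp S1) (mcomp S2) _ _ _ _ _ _ _ h b one Dl Y) => /=.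
- by move=> z; rewrite mcompA TT comp0f.
- by move=> z; rewrite !mcompA CS.
- by move=> z; rewrite !mcompA -[(S2 ⊙ S1) ⊙ T]mcompA SST !mcompA.
- by move=> z; rewrite mcompA TA compDl !comp_sgl comp1f -mcompA.
- by move=> z; rewrite !mcompA CA.
- by move=> z; rewrite !mcompA BA comp_sgl.
- by move=> z; rewrite !mcompA AS comp_sgl.
- move=> z Sz Cz; apply: inj1 => // m lt_m.
  by rewrite -mcompA -iter_mcomp; apply: Cz.
- move=> z Sz Cz; apply: inj2 => // m lt_m.
  by rewrite -mcompA -iter_mcomp; apply: Cz.
- exact: S1Y.
- by move=> m lt_m; rewrite iter_mcomp mcompA CY.
- exact: S2D.
- by move=> m lt_m; rewrite iter_mcomp mcompA CD0.
- by rewrite -/(iter h.+1 (mcomp A') Dl) iter_mcomp mcompA.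
Qed.

(** The opposite category: all composites of [zigzag_column] are reversed, and the additive maps are
    now precompositions. *)
Lemma zigzag_row (a : mor la w0 w0) (T A B : mor la w1 w1)
    (A' : mor la w2 w2) (T' : mor la w3 w3) (C : mor la w0 w1)
    (C' : mor la w0 w2) (S1 : mor la w2 w1) (S2 : mor la w3 w2)
    (h : nat) (b : bool) (one : mor la w0 w0) (Dl : mor la w2 w0)
    (Y : mor la w1 w0) :
  T ⊙ T = 0 -> S1 ⊙ C' = T ⊙ C -> T ⊙ S1 ⊙ S2 = S1 ⊙ S2 ⊙ T' ->
  A ⊙ T = sg p (T ⊙ B) + sg e (idm la w1) -> A ⊙ C = C ⊙ a ->
  A ⊙ B = sg p (B ⊙ A) -> S1 ⊙ A' = sg p (A ⊙ S1) ->
  (forall f : mor la w1 w0, f ⊙ S1 = 0 ->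
     (forall m, (m < h)%N -> f ⊙ (mpow m B ⊙ C) = 0) -> f = 0) ->
  (forall f : mor la w2 w0, f ⊙ S2 = 0 ->
     (forall m, (m < h.+2)%N -> f ⊙ (mpow m A' ⊙ C') = 0) -> f = 0) ->
  Y ⊙ S1 = - Dl ->
  (forall m, (m < h)%N -> Y ⊙ (mpow m B ⊙ C) = 0) ->
  Dl ⊙ S2 = 0 ->
  (forall m, (m < h.+1)%N -> Dl ⊙ (mpow m A' ⊙ C') = 0) ->
  Dl ⊙ (mpow h.+1 A' ⊙ C') = sg b one ->
  Y ⊙ (mpow h B ⊙ C) = sg (~~ p (+) e (+) b) one.
Proof.
move=> TT CS SST TA CA BA AS inj1 inj2 S1Y CY S2D CD0 CD1.
rewrite mcompA -iter_compr.
apply: (@zigzag_dots (mor la w0 w0) (mor la w1 w0) (mor la w2 w0) (mor la w3 w0)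
  p e (compr a) (compr T) (compr A) (compr B) (compr A') (compr T') (compr C)
  (compr C') (compr S1) (compr S2) _ _ _ _ _ _ _ h b one Dl Y);
  rewrite /= ?/compr.
- by move=> z; rewrite -mcompA TT compf0.
- by move=> z; rewrite -!mcompA CS.
- by move=> z; rewrite -!mcompA SST.
- by move=> z; rewrite -mcompA TA compDr !comp_sgr compf1 mcompA.
- by move=> z; rewrite -!mcompA CA.
- by move=> z; rewrite -!mcompA BA comp_sgr.
- by move=> z; rewrite -!mcompA AS comp_sgr.
- move=> z Sz Cz; apply: inj1 => // m lt_m.
  by rewrite mcompA -iter_compr; apply: Cz.
- move=> z Sz Cz; apply: inj2 => // m lt_m.
  by rewrite mcompA -iter_compr; apply: Cz.
- exact: S1Y.
- by move=> m lt_m; rewrite [iter _ _ _]iter_compr -mcompA CY.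
- exact: S2D.
- by move=> m lt_m; rewrite [iter _ _ _]iter_compr -mcompA CD0.
- by rewrite -CD1 [in RHS]mcompA -iter_compr.
Qed.

Lemma zigzag_flat (T : mor la w1 w1) (T' : mor la w3 w3) (C : mor la w1 w0)
    (C' : mor la w2 w0) (S1 : mor la w1 w2) (S2 : mor la w2 w3)
    (U : mor la w0 w2) (V : mor la w0 w3) (g : mor la w0 w0)
    (Dl : mor la w0 w2) (Y : mor la w0 w1) :
  T ⊙ T = 0 -> C' ⊙ S1 = C ⊙ T -> S2 ⊙ S1 ⊙ T = T' ⊙ S2 ⊙ S1 -> T' ⊙ T' = 0 ->
  (forall f : mor la w0 w1, S1 ⊙ f = 0 -> f = 0) ->
  (forall f : mor la w0 w2, S2 ⊙ f = 0 -> C' ⊙ f = 0 -> f = 0) ->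
  C' ⊙ U = idm la w0 -> S2 ⊙ U = T' ⊙ V -> S1 ⊙ Y = - Dl + U ⊙ g ->
  S2 ⊙ Dl = 0 -> C' ⊙ Dl = idm la w0 -> g = idm la w0.
Proof.
move=> TT CS SST TT' inj1 inj2 CU SU S1Y S2D CD.
apply: (@zigzag_nodots (mor la w0 w0) (mor la w0 w1) (mor la w0 w2)
  (mor la w0 w3) (mcomp T) (mcomp T') (mcomp C) (mcomp C') (mcomp S1) (mcomp S2)
  _ _ _ (mcomp U) (mcomp V) _ _ Dl Y) => //=.
- by move=> z; rewrite mcompA TT comp0f.
- by move=> z; rewrite !mcompA CS.
- by move=> z; rewrite !mcompA -[(S2 ⊙ S1) ⊙ T]mcompA SST !mcompA.
- by move=> z; rewrite mcompA TT' comp0f.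
- by move=> z; rewrite mcompA CU comp1f.
- by move=> z; rewrite !mcompA SU.
Qed.

End ZigzagMorphisms.

(** * Upward and downward strands *)

Section Generators.
Variable i : I.
Local Notation E := (E i).
Local Notation F := (F i).
Local Notation p := (par D i).

(* In the definitions below z is a word of identity strands on the right. *)
Definition cap1 mu : mor mu [:: E; F] [::] := cls (teps i).
Definition cap la z : mor la (E :: F :: z) z := wr z (cap1 (tgt la z)).
Definition cup1 mu : mor mu [::] [:: F; E] := cls (teta i).
Definition cup la z : mor la z (F :: E :: z) := wr z (cup1 (tgt la z)).
Definition dot1 mu : mor mu [:: E] [:: E] := cls (tx i).
Definition dot la z : mor la (E :: z) (E :: z) := wr z (dot1 (tgt la z)).
Definition cross1 mu : mor mu [:: E; E] [:: E; E] := cls (ttau i i).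
Definition cross la z : mor la (E :: E :: z) (E :: E :: z) :=
  wr z (cross1 (tgt la z)).
Definition rcross1 mu : mor mu [:: E; F] [:: F; E] := cls (sigma i i).
Definition rcross la z : mor la (E :: F :: z) (F :: E :: z) :=
  wr z (rcross1 (tgt la z)).

Lemma hg_cap la z : hg false (cap la z).
Proof. exact: (hg_wr z (hg_cls (homog_eps K _ i))). Qed.
Lemma hg_cup la z : hg false (cup la z).
Proof. exact: (hg_wr z (hg_cls (homog_eta K _ i))). Qed.
Lemma hg_dot la z : hg p (dot la z).
Proof. exact: (hg_wr z (hg_cls (homog_x K _ i))). Qed.
Lemma hg_cross la z : hg p (cross la z).
Proof.
rewrite -[p]andbb; exact: (hg_wr z (hg_cls (homog_tau K _ i i))).
Qed.

#[local] Instance hom_cap la z : homogeneous (cap la z).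
Proof. by exists false; apply: hg_cap. Qed.
#[local] Instance hom_cup la z : homogeneous (cup la z).
Proof. by exists false; apply: hg_cup. Qed.
#[local] Instance hom_dot la z : homogeneous (dot la z).
Proof. by exists p; apply: hg_dot. Qed.
#[local] Instance hom_cross la z : homogeneous (cross la z).
Proof. by exists p; apply: hg_cross. Qed.

Lemma capM la v v' (g : mor la v v') {hm : homogeneous g} :
  cap la v' ⊙ lw E (lw F g) = g ⊙ cap la v.
Proof.
case: hm => q hgg; have := exch (fun mu => hg_cls (homog_eps K mu i)) hgg.
by rewrite wl0 (wl_cons _ [:: F] g).
Qed.

Lemma cupM la v v' (g : mor la v v') {hm : homogeneous g} :
  lw F (lw E g) ⊙ cup la v = cup la v' ⊙ g.
Proof.
case: hm => q hgg; have := exch (fun mu => hg_cls (homog_eta K mu i)) hgg.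
by rewrite wl0 (wl_cons _ [:: E] g).
Qed.

Lemma dotM q la v v' (g : mor la v v') : hg q g ->
  dot la v' ⊙ lw E g = sg (p && q) (lw E g ⊙ dot la v).
Proof. exact: (exch (fun mu => hg_cls (homog_x K mu i))). Qed.

Lemma crossM q la v v' (g : mor la v v') : hg q g ->
  cross la v' ⊙ lw E (lw E g) = sg (p && q) (lw E (lw E g) ⊙ cross la v).
Proof.
move=> hgg; have := exch (fun mu => hg_cls (homog_tau K mu i i)) hgg.
by rewrite (wl_cons _ [:: E] g) andbb.
Qed.

Lemma cap_cons la c z :
  cap la (c :: z) = wr z (wr [:: c] (cap1 _)).
Proof.
exact: (@wr_cat la [:: c] _ _ z (cap1 _) erefl erefl erefl).
Qed.

Lemma cup_cons la c z :
  cup la (c :: z) = wr z (wr [:: c] (cup1 _)).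
Proof.
exact: (@wr_cat la [:: c] _ _ z (cup1 _) erefl erefl erefl).
Qed.

Lemma dot_cons la c z :
  dot la (c :: z) = wr z (wr [:: c] (dot1 _)).
Proof.
exact: (@wr_cat la [:: c] _ _ z (dot1 _) erefl erefl erefl).
Qed.

Lemma cross_cons la c z :
  cross la (c :: z) = wr z (wr [:: c] (cross1 _)).
Proof.
exact: (@wr_cat la [:: c] _ _ z (cross1 _) erefl erefl erefl).
Qed.

#[local] Instance hom_cap1 mu : homogeneous (cap1 mu).
Proof. by exists false; apply/hg_cls/homog_eps. Qed.
#[local] Instance hom_cup1 mu : homogeneous (cup1 mu).
Proof. by exists false; apply/hg_cls/homog_eta. Qed.
#[local] Instance hom_dot1 mu : homogeneous (dot1 mu).
Proof. by exists p; apply/hg_cls/homog_x. Qed.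
#[local] Instance hom_cross1 mu : homogeneous (cross1 mu).
Proof. by exists (p && p); apply/hg_cls/homog_tau. Qed.

Lemma zigE la z : cap la (E :: z) ⊙ lw E (cup la z) = idm la (E :: z).
Proof.
have z1 mu : wr [:: E] (cap1 _) ⊙ lw E (cup1 mu) = idm mu [:: E].
  rewrite /lw /wr /wl /idm -!cls_hc -cls_comp.
  apply/clsP/eqv_rel; exact: zigzagE.
have := congr1 (wr z) (z1 (tgt la z)).
by rewrite wrM -lw_wr wr_id cap_cons.
Qed.

Lemma zigF la z : lw F (cap la z) ⊙ cup la (F :: z) = idm la (F :: z).
Proof.
have z1 mu : lw F (cap1 mu) ⊙ wr [:: F] (cup1 _) = idm mu [:: F].
  rewrite /lw /wr /wl /idm -!cls_hc -cls_comp.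
  apply/clsP/eqv_rel; exact: zigzagF.
have := congr1 (wr z) (z1 (tgt la z)).
by rewrite wrM -lw_wr wr_id cup_cons.
Qed.

Lemma cls_subE mu v w (f g h : tm mu v w) (b : bool) :
  eqv (f - (-1) ^+ b *: g)%tm h -> cls f = sg b (cls g) + cls h.
Proof.
move/clsP; rewrite cls_add !cls_scl sclN1 scl_sgn => <-.
by rewrite addrC subrK.
Qed.

Lemma crossK la z : cross la z ⊙ cross la z = 0.
Proof.
have c1 mu : cross1 mu ⊙ cross1 mu = 0.
  rewrite -cls_comp -(cls_zero (erefl (tgt mu [:: E; E]))).
  exact/clsP/eqv_rel/quad_same.
have := congr1 (wr z) (c1 (tgt la z)).
by rewrite wrM raddf0.
Qed.

Lemma cross_dotl la z : cross la z ⊙ dot la (E :: z) =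
  sg p (lw E (dot la z) ⊙ cross la z) + idm la (E :: E :: z).
Proof.
have c1 mu : cross1 mu ⊙ wr [:: E] (dot1 _) =
    sg p (lw E (dot1 _) ⊙ cross1 _) + idm mu [:: E; E].
  rewrite /lw /wr /wl /idm -!cls_hc -!cls_comp.
  by apply: cls_subE; have := dotl_same Q mu i; rewrite andbb => /eqv_rel.
have := congr1 (wr z) (c1 (tgt la z)).
by rewrite wrD wr_sg wr_id !wrM -lw_wr dot_cons.
Qed.

Lemma cross_dotr la z : dot la (E :: z) ⊙ cross la z =
  sg p (cross la z ⊙ lw E (dot la z)) + idm la (E :: E :: z).
Proof.
have c1 mu : wr [:: E] (dot1 _) ⊙ cross1 mu =
    sg p (cross1 _ ⊙ lw E (dot1 _)) + idm mu [:: E; E].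
  rewrite /lw /wr /wl /idm -!cls_hc -!cls_comp.
  by apply: cls_subE; have := dotr_same Q mu i; rewrite andbb => /eqv_rel.
have := congr1 (wr z) (c1 (tgt la z)).
by rewrite wrD wr_sg wr_id !wrM -lw_wr dot_cons.
Qed.

Lemma braid la z :
  cross la (E :: z) ⊙ lw E (cross la z) ⊙ cross la (E :: z) =
  lw E (cross la z) ⊙ cross la (E :: z) ⊙ lw E (cross la z).
Proof.
have c1 mu : wr [:: E] (cross1 _) ⊙ lw E (cross1 mu) ⊙ wr [:: E] (cross1 _) =
    lw E (cross1 mu) ⊙ wr [:: E] (cross1 _) ⊙ lw E (cross1 mu).
  have e : tgt mu [:: E; E; E] = tgt mu [:: E; E; E] by [].
  apply/eqP; rewrite -subr_eq0 -(cls_zero e) -sclN1.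
  rewrite /lw /wr /wl /idm -!cls_hc -!cls_comp -cls_scl -cls_add.
  apply/eqP/clsP.
  by apply/eqv_rel/braid_diff; rewrite eqxx.
have := congr1 (wr z) (c1 (tgt la z)).
by rewrite !wrM -!lw_wr cross_cons.
Qed.

Lemma rcross1E mu : rcross1 mu =
  lw F (lw E (cap1 mu)) ⊙ lw F (wr [:: F] (cross1 _)) ⊙ wr [:: E; F] (cup1 _).
Proof.
rewrite /lw -(wl_cons F [:: E]) /wr /wl /idm -!cls_hc -!cls_comp; apply/clsP.
exact: eqv_refl.
Qed.

#[local] Instance hom_rcross1 mu : homogeneous (rcross1 mu).
Proof. by rewrite rcross1E; apply _. Qed.

Lemma rcrossE la z : rcross la z =
  lw F (lw E (cap la z)) ⊙ lw F (cross la (F :: z)) ⊙ cup la (E :: F :: z).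
Proof.
rewrite /rcross rcross1E !wrM -!lw_wr cross_cons.
have -> // : cup la (E :: F :: z) = wr z (wr [:: E; F] (cup1 _)).
exact: (@wr_cat la [:: E; F] _ _ z (cup1 _) erefl erefl erefl).
Qed.

(** The bijection Hom(E u, v) = Hom(u, F v) of the adjunction [(eta, eps)]. Relations between bent
    diagrams are proved by computing inside a mate, where only upward crossings and dots occur. *)
Definition mate la u v (f : mor la (E :: u) v) : mor la u (F :: v) :=
  lw F f ⊙ cup la u.

Definition unmate la u v (g : mor la u (F :: v)) : mor la (E :: u) v :=
  cap la v ⊙ lw E g.

Lemma mateK la u v (f : mor la (E :: u) v) {hf : homogeneous f} :
  unmate (mate f) = f.
Proof.
by rewrite /unmate /mate lwM mcompA capM -mcompA zigE compf1.
Qed.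

Lemma hg_mate q la u v (f : mor la (E :: u) v) : hg q f -> hg q (mate f).
Proof.
by move=> hf; rewrite -[q]addbF; apply: hg_comp (hg_lw _ hf) (hg_cup _ _).
Qed.

#[local] Instance hom_mate la u v (f : mor la (E :: u) v) {hf : homogeneous f} :
  homogeneous (mate f).
Proof. by rewrite /mate; apply _. Qed.



Lemma mate_comp la u u' v (f : mor la (E :: u) v) (k : mor la u' u)
  {hf : homogeneous f} {hk : homogeneous k} :
  mate f ⊙ k = mate (f ⊙ lw E k).
Proof. by rewrite /mate lwM -!mcompA cupM. Qed.

Lemma lwF_mate la u v v' (f : mor la (E :: u) v) (g : mor la v v')
  {hg : homogeneous g} : lw F g ⊙ mate f = mate (g ⊙ f).
Proof. by rewrite /mate lwM mcompA. Qed.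

Lemma mate_sg la u v b (f : mor la (E :: u) v) : mate (sg b f) = sg b (mate f).
Proof. by rewrite /mate lw_sg comp_sgl. Qed.

Lemma mateD la u v (f g : mor la (E :: u) v) : mate (f + g) = mate f + mate g.
Proof. by rewrite /mate lwD compDl. Qed.

Lemma mate0 la u v : mate (0 : mor la (E :: u) v) = 0.
Proof. by rewrite /mate lw0 comp0f. Qed.

Lemma mate_cap la z : mate (cap la z) = idm la (F :: z).
Proof. exact: zigF. Qed.

(** The formula defining [sigma] is itself a mate, so capping off a rightward crossing gives back an
    upward one. *)
Lemma rcross_mate la z :
  rcross la z = mate (lw E (cap la z) ⊙ cross la (F :: z)).
Proof. by rewrite rcrossE /mate lwM mcompA. Qed.

Lemma hg_rcross la z : hg p (rcross la z).
Proof.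
rewrite rcross_mate; apply: hg_mate.
exact: (hg_comp (hg_lw E (hg_cap _ _)) (hg_cross _ _)).
Qed.

#[local] Instance hom_rcross la z : homogeneous (rcross la z).
Proof. by exists p; apply: hg_rcross. Qed.

Lemma cap_rcross la z :
  cap la (E :: z) ⊙ lw E (rcross la z) = lw E (cap la z) ⊙ cross la (F :: z).
Proof. by rewrite rcross_mate [LHS]mateK. Qed.

Lemma rcrossM q la v v' (g : mor la v v') : hg q g ->
  rcross la v' ⊙ lw E (lw F g) = sg (p && q) (lw F (lw E g) ⊙ rcross la v).
Proof.
move=> hgg; have homg : homogeneous g by exists q.
rewrite !rcross_mate mate_comp -mcompA (crossM (hg_lw F hgg)) lwF_mate.
by rewrite comp_sgr mate_sg !mcompA -!lwM capM.
Qed.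

Lemma rcross_cup la z :
  rcross la (E :: z) ⊙ lw E (cup la z) = lw F (cross la z) ⊙ cup la (E :: z).
Proof.
rewrite rcross_mate mate_comp -mcompA (crossM (hg_cup _ _)) andbF /=.
by rewrite mcompA -lwM zigE lw_id comp1f.
Qed.

(** The braid relation with its third strand bent: up to one common sign, the two sides are mates of
    the two sides of [braid], closed by a cap. *)
Lemma rcross_braid la z :
  rcross la (E :: z) ⊙ lw E (rcross la z) ⊙ cross la (F :: z) =
  lw F (cross la z) ⊙ rcross la (E :: z) ⊙ lw E (rcross la z).
Proof.
rewrite mcompA; set P := rcross _ _ ⊙ _.
have -> : P = sg p (mate (lw E (lw E (cap la z)) ⊙ lw E (cross la (F :: z))
    ⊙ cross la (E :: F :: z))).
  rewrite /P rcross_mate mate_comp -mcompA (crossM (hg_rcross _ _)) andbb.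
  by rewrite comp_sgr mate_sg mcompA -lwM cap_rcross lwM -mcompA.
rewrite comp_sgl comp_sgr; congr (sg _ _).
rewrite mate_comp lwF_mate -!mcompA -braid !mcompA.
by rewrite (crossM (hg_cap _ _)) andbF.
Qed.

(* Dot and crossing of downward strands. *)
Definition ddot la z : mor la (F :: z) (F :: z) :=
  mate (cap la z ⊙ dot la (F :: z)).

Definition cap2 la z : mor la (E :: E :: F :: F :: z) z :=
  cap la z ⊙ lw E (cap la (F :: z)).

Definition dcross la z : mor la (F :: F :: z) (F :: F :: z) :=
  mate (mate (cap2 la z ⊙ cross la (F :: F :: z))).

Lemma hg_ddot la z : hg p (ddot la z).
Proof. by apply: hg_mate; apply: (hg_comp (hg_cap _ _) (hg_dot _ _)). Qed.

#[local] Instance hom_ddot la z : homogeneous (ddot la z).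
Proof. by exists p; apply: hg_ddot. Qed.

Lemma hg_cap2 la z : hg false (cap2 la z).
Proof. exact: (hg_comp (hg_cap _ _) (hg_lw E (hg_cap _ _))). Qed.

#[local] Instance hom_cap2 la z : homogeneous (cap2 la z).
Proof. by exists false; apply: hg_cap2. Qed.

Lemma hg_dcross la z : hg p (dcross la z).
Proof.
by do 2!apply: hg_mate; apply: (hg_comp (hg_cap2 _ _) (hg_cross _ _)).
Qed.

#[local] Instance hom_dcross la z : homogeneous (dcross la z).
Proof. by exists p; apply: hg_dcross. Qed.

Lemma cap_ddot la z : cap la z ⊙ lw E (ddot la z) = cap la z ⊙ dot la (F :: z).
Proof. by rewrite [LHS]mateK. Qed.

Lemma cap_dcross la z : cap la (F :: z) ⊙ lw E (dcross la z) =
  mate (cap2 la z ⊙ cross la (F :: F :: z)).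
Proof. by rewrite [LHS]mateK. Qed.

Lemma cap2_dcross la z : cap2 la z ⊙ lw E (lw E (dcross la z)) =
  cap2 la z ⊙ cross la (F :: F :: z).
Proof. by rewrite -mcompA -lwM cap_dcross [LHS]mateK. Qed.

Lemma ddotM q la v v' (g : mor la v v') : hg q g ->
  ddot la v' ⊙ lw F g = sg (p && q) (lw F g ⊙ ddot la v).
Proof.
move=> hgg; have homg : homogeneous g by exists q.
rewrite mate_comp -mcompA (dotM (hg_lw F hgg)) lwF_mate.
by rewrite comp_sgr mate_sg !mcompA capM.
Qed.

Lemma ddot_cup la z : ddot la (E :: z) ⊙ cup la z = lw F (dot la z) ⊙ cup la z.
Proof.
rewrite mate_comp -mcompA (dotM (hg_cup _ _)) andbF /=.
by rewrite mcompA zigE comp1f.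
Qed.

(** Inside the double mate, one downward crossing is pulled past the upward one and through the
    nested caps, which turns it into a second upward crossing. *)
Lemma dcrossK la z : dcross la z ⊙ dcross la z = 0.
Proof.
rewrite {1}/dcross !mate_comp -mcompA (crossM (hg_dcross _ _)) comp_sgr.
by rewrite mcompA cap2_dcross -mcompA crossK compf0 sg0 !mate0.
Qed.

(** The double mate of [cross_dotr]. The sign on the identity term comes from exchanging the
    crossing with the bent dot before [cross_dotr] applies. *)
Lemma dcross_dot la z : dcross la z ⊙ lw F (ddot la z) =
  sg p (ddot la (F :: z) ⊙ dcross la z) + sg p (idm la (F :: F :: z)).
Proof.
have -> : ddot la (F :: z) ⊙ dcross la z = sg p (mate (mate
    (cap2 la z ⊙ cross la (F :: F :: z) ⊙ lw E (dot la (F :: F :: z))))).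
  rewrite mate_comp -mcompA (dotM (hg_dcross _ _)) andbb comp_sgr mcompA.
  by rewrite cap_dcross mate_comp mate_sg -mcompA.
have -> : idm la (F :: F :: z) = mate (mate (cap2 la z)).
  by rewrite /cap2 -mate_comp mate_cap comp1f mate_cap.
rewrite {1}/dcross !mate_comp -mcompA (crossM (hg_lw F (hg_ddot _ _))) andbb.
have c2d : cap2 la z ⊙ lw E (lw E (lw F (ddot la z))) =
    cap2 la z ⊙ dot la (E :: F :: F :: z).
  rewrite /cap2 -mcompA -lwM capM lwM mcompA cap_ddot -!mcompA.
  by rewrite (dotM (hg_cap _ _)) andbF.
rewrite comp_sgr mcompA c2d -mcompA cross_dotr compDr compf1 comp_sgr.
by rewrite !mate_sg !mateD !mate_sg sgD !sg_sg.
Qed.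

Lemma cap_rcross_down la z : lw F (cap la z) ⊙ rcross la (F :: z) =
  cap la (F :: z) ⊙ lw E (dcross la z).
Proof. by rewrite cap_dcross rcross_mate lwF_mate mcompA. Qed.

Lemma rcross_cup_down la z : lw F (rcross la z) ⊙ cup la (F :: z) =
  dcross la (E :: z) ⊙ lw F (cup la z).
Proof.
rewrite [LHS]/(mate (rcross la z)) !mate_comp -mcompA.
rewrite (crossM (hg_lw F (hg_cup _ _))) andbF /= mcompA.
have -> : cap2 la (E :: z) ⊙ lw E (lw E (lw F (cup la z))) = lw E (cap la z).
  by rewrite /cap2 -mcompA -lwM capM lwM mcompA zigE comp1f.
by rewrite -rcross_mate.
Qed.

Lemma rcross_braid_down la z :
  lw F (rcross la z) ⊙ rcross la (F :: z) ⊙ lw E (dcross la z) =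
  dcross la (E :: z) ⊙ lw F (rcross la z) ⊙ rcross la (F :: z).
Proof.
(* [M] contains two of the three crossings of the braid word. The third is added below [M] on the
   right-hand side; on the left-hand side it is the downward crossing pulled up through the caps. *)
pose M := lw E (cap2 la z) ⊙ cross la (E :: F :: F :: z)
  ⊙ lw E (cross la (F :: F :: z)).
rewrite mcompA; set P := lw F _ ⊙ _.
have PE : P = mate (mate M).
  rewrite /P (rcross_mate _ (F :: z)) lwF_mate rcross_mate mate_comp.
  congr (mate (mate _)); rewrite /M -mcompA lwM [cross _ _ ⊙ _]mcompA.
  by rewrite (crossM (hg_cap _ _)) andbF /= -mcompA mcompA -lwM.
(* Two crossings of parity [p] are even together, so [P] passes the third crossing without a
   sign. *)
have hP : hg false P.
  rewrite -(addbb p).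
  exact: (hg_comp (hg_lw F (hg_rcross _ _)) (hg_rcross _ _)).
have homP : homogeneous P by exists false.
have cP : cap2 la (E :: z) ⊙ lw E (lw E P) = M.
  by rewrite /cap2 -mcompA -lwM PE [X in lw E X]mateK [LHS]mateK.
rewrite {2}/dcross !mate_comp -[(cap2 _ _ ⊙ _) ⊙ _]mcompA (crossM hP) andbF /=.
rewrite [cap2 _ _ ⊙ _]mcompA cP PE !mate_comp; congr (mate (mate _)).
rewrite /M -!mcompA -[lw E (cross _ _) ⊙ lw E (lw E _)]lwM.
rewrite (crossM (hg_dcross _ _)) andbb lw_sg lwM !comp_sgr.
rewrite [cross _ _ ⊙ _]mcompA (crossM (hg_lw E (hg_dcross _ _))) andbb.
rewrite comp_sgl comp_sgr sg_sg addbb /= -!mcompA mcompA -lwM cap2_dcross.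
by rewrite lwM -!mcompA -braid.
Qed.

(** * Dotted caps and cups, and the entries of the adjoined inverses *)

Definition dotn la z m := mpow m (dot la z).
Definition capn la z m := cap la z ⊙ dotn la (F :: z) m.
Definition cupn la z m := lw F (dotn la z m) ⊙ cup la z.

#[local] Instance hom_capn la z m : homogeneous (capn la z m).
Proof. by rewrite /capn /dotn; apply _. Qed.
#[local] Instance hom_cupn la z m : homogeneous (cupn la z m).
Proof. by rewrite /cupn /dotn; apply _. Qed.

Lemma cls_xpow mu m : cls (xpow i m) = mpow m (dot1 mu).
Proof. by elim: m => //= m IH; rewrite cls_comp IH. Qed.

Lemma cls_dotcap mu m : cls (dotcap i m) =
  cap1 mu ⊙ wr [:: F] (mpow m (dot1 _)).
Proof.
rewrite cls_comp -cls_xpow; congr (_ ⊙ _).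
exact: (cls_hc (xpow i m) (tid [:: F])).
Qed.

Lemma cls_dotcup mu m : cls (dotcup i m) =
  lw F (mpow m (dot1 _)) ⊙ cup1 mu.
Proof.
rewrite cls_comp -cls_xpow; congr (_ ⊙ _).
exact: (cls_hc (tid [:: F]) (xpow i m)).
Qed.

#[local] Instance hom_cls_dotcap mu m :
  homogeneous (cls (dotcap i m : tm mu _ _)).
Proof.
have hm : homogeneous (wr [:: F] (mpow m (dot1 (tgt mu [:: F])))).
  exact: hom_wr.
by rewrite cls_dotcap; exact: (hom_comp (hf := hom_cap1 _) (hg := hm)).
Qed.
#[local] Instance hom_cls_dotcup mu m :
  homogeneous (cls (dotcup i m : tm mu _ _)).
Proof. by rewrite cls_dotcup; apply _. Qed.

Lemma dotcapE la z m : wr z (cls (dotcap i m)) = capn la z m.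
Proof.
have hm : homogeneous (wr [:: F] (mpow m (dot1 (tgt (tgt la z) [:: F])))).
  exact: hom_wr.
by rewrite cls_dotcap wrM !wr_mpow /capn /dotn dot_cons.
Qed.

Lemma dotcupE la z m : wr z (cls (dotcup i m)) = cupn la z m.
Proof. by rewrite cls_dotcup wrM -lw_wr wr_mpow. Qed.

Definition linv la z : mor la (F :: E :: z) (E :: F :: z) :=
  wr z (cls (tinv i i)).
Definition delt la z (n : 'I_(natpos (pairing i (tgt la z)))) :
  mor la z (E :: F :: z) := wr z (cls (tdelta n)).
Definition gamm la z (n : 'I_(natpos (- pairing i (tgt la z)))) :
  mor la (F :: E :: z) z := wr z (cls (tgamma n)).

#[local] Instance hom_cls_inv mu : homogeneous (cls (tinv i i : tm mu _ _)).
Proof. by exists (p && p); apply/hg_cls/homog_inv. Qed.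
#[local] Instance hom_cls_delta mu n :
  homogeneous (cls (@tdelta _ _ _ _ mu i n)).
Proof. by exists (p && odd n); apply/hg_cls/homog_delta. Qed.
#[local] Instance hom_cls_gamma mu n :
  homogeneous (cls (@tgamma _ _ _ _ mu i n)).
Proof. by exists (p && odd n); apply/hg_cls/homog_gamma. Qed.
#[local] Instance hom_linv la z : homogeneous (linv la z).
Proof. exact: (hom_wr (f := cls (tinv i i))). Qed.
#[local] Instance hom_delt la z n : homogeneous (@delt la z n).
Proof. exact: (hom_wr (f := cls (tdelta n))). Qed.
#[local] Instance hom_gamm la z n : homogeneous (@gamm la z n).
Proof. exact: (hom_wr (f := cls (tgamma n))). Qed.

Lemma wr_vc la z u v w (f : tm (tgt la z) v w) (g : tm (tgt la z) u v) h
  {hg : homogeneous (cls g)} : eqv (tvc f g) h ->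
  wr z (cls f) ⊙ wr z (cls g) = wr z (cls h).
Proof. by move=> /clsP <-; rewrite cls_comp wrM. Qed.

Lemma cls_tsum (A : Type) la w (r : seq A) (f : A -> tm la w w) :
  cls (tsum r f) = \sum_(a <- r) cls (f a).
Proof.
elim: r => [|a r IH]; first by rewrite big_nil [LHS]cls_zero.
by rewrite big_cons -IH -cls_add.
Qed.


Lemma wr_cls_id la z w : wr z (cls (tid w)) = idm la (w ++ z).
Proof. exact: wr_id. Qed.

Lemma wr_cls0 la z v w e : wr z (cls (tzero e : tm (tgt la z) v w)) = 0.
Proof. by rewrite cls_zero raddf0. Qed.

Section Column.
Variables (la : weight D) (z : word I).
Local Notation h := (pairing i (tgt la z)).
Hypothesis h_ge0 : 0 <= h.

Lemma rcross_linv : rcross la z ⊙ linv la z = idm la (F :: E :: z).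
Proof.
exact: (etrans (wr_vc (eqv_rel (inv_pos_ss Q h_ge0))) (wr_cls_id _ _ _)).
Qed.

Lemma rcross_delt n : rcross la z ⊙ @delt la z n = 0.
Proof.
have e := parallel (tvc (sigma i i) (tdelta n) : tm (tgt la z) _ _).
exact: (etrans (wr_vc (eqv_rel (inv_pos_sd Q n e h_ge0))) (wr_cls0 e)).
Qed.

Lemma capn_linv m : (m < natpos h)%N -> capn la z m ⊙ linv la z = 0.
Proof.
move=> lt_m; rewrite -[m]/(val (Ordinal lt_m)); move: {m lt_m}(Ordinal _) => m.
have e := parallel (tvc (dotcap i m) (tinv i i) : tm (tgt la z) _ _).
rewrite -dotcapE.
exact: (etrans (wr_vc (eqv_rel (inv_pos_ds Q m e h_ge0))) (wr_cls0 e)).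
Qed.

Lemma capn_delt m n : (m < natpos h)%N ->
  capn la z m ⊙ @delt la z n = if m == n then idm la z else 0.
Proof.
move=> lt_m; rewrite -[m]/(val (Ordinal lt_m)); move: {m lt_m}(Ordinal _) => m.
rewrite val_eqE.
rewrite -dotcapE.
refine (etrans (wr_vc (eqv_rel (inv_pos_dd Q m n h_ge0))) _).
rewrite cls_scl; case: (m == n).
  by rewrite scl1 wr_cls_id.
by rewrite scl0 raddf0.
Qed.

Lemma column_sum : linv la z ⊙ rcross la z +
  \sum_n @delt la z n ⊙ capn la z n = idm la (E :: F :: z).
Proof.
have /clsP := eqv_rel (inv_pos_l Q h_ge0); rewrite cls_add cls_tsum.
move=> /(congr1 (wr z)); rewrite wrD cls_comp wrM wr_cls_id => <-.
congr (_ + _); rewrite raddf_sum big_enum; apply: eq_bigr => n _.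
by rewrite cls_comp /= wrM dotcapE.
Qed.


(** The column has a left inverse, so its entries are jointly injective; in this form (R5) provides
    the tests of the zigzag computation. Dually, the right inverse of a row gives [row_inj]. *)
Lemma column_inj u (f : mor la u (E :: F :: z)) : rcross la z ⊙ f = 0 ->
  (forall m, (m < natpos h)%N -> capn la z m ⊙ f = 0) -> f = 0.
Proof.
move=> rf cf; rewrite -[f]comp1f -column_sum compDl -mcompA rf compf0 add0r.
by rewrite comp_suml big1 // => n _; rewrite -mcompA cf // compf0.
Qed.

Lemma column_inj_lw c u (f : mor la u (c :: E :: F :: z)) :
  lw c (rcross la z) ⊙ f = 0 ->
  (forall m, (m < natpos h)%N -> lw c (capn la z m) ⊙ f = 0) -> f = 0.
Proof.
move=> rf cf; rewrite -[f]comp1f -lw_id -column_sum lwD compDl lwM -mcompA rf.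
rewrite compf0 add0r lw_sum comp_suml big1 // => n _.
by rewrite lwM -mcompA cf // compf0.
Qed.

End Column.

Section Row.
Variables (la : weight D) (z : word I).
Local Notation h := (pairing i (tgt la z)).
Hypothesis h_le0 : h <= 0.

Lemma linv_rcross : linv la z ⊙ rcross la z = idm la (E :: F :: z).
Proof.
exact: (etrans (wr_vc (eqv_rel (inv_neg_ss Q h_le0))) (wr_cls_id _ _ _)).
Qed.

Lemma gamm_rcross n : @gamm la z n ⊙ rcross la z = 0.
Proof.
have e := parallel (tvc (tgamma n) (sigma i i) : tm (tgt la z) _ _).
exact: (etrans (wr_vc (eqv_rel (inv_neg_ds Q n e h_le0))) (wr_cls0 e)).
Qed.

Lemma linv_cupn m : (m < natpos (- h))%N -> linv la z ⊙ cupn la z m = 0.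
Proof.
move=> lt_m; rewrite -[m]/(val (Ordinal lt_m)); move: {m lt_m}(Ordinal _) => m.
have e := parallel (tvc (tinv i i) (dotcup i m) : tm (tgt la z) _ _).
rewrite -dotcupE.
exact: (etrans (wr_vc (eqv_rel (inv_neg_sd Q m e h_le0))) (wr_cls0 e)).
Qed.

Lemma gamm_cupn m n : (n < natpos (- h))%N ->
  @gamm la z m ⊙ cupn la z n = if m == n :> nat then idm la z else 0.
Proof.
move=> lt_n; rewrite -[n]/(val (Ordinal lt_n)); move: {n lt_n}(Ordinal _) => n.
rewrite val_eqE.
rewrite -dotcupE.
refine (etrans (wr_vc (eqv_rel (inv_neg_dd Q m n h_le0))) _).
rewrite cls_scl; case: (m == n); first by rewrite scl1 wr_cls_id.
by rewrite scl0 raddf0.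
Qed.

Lemma row_sum : rcross la z ⊙ linv la z +
  \sum_(n < natpos (- h)) cupn la z n ⊙ @gamm la z n = idm la (F :: E :: z).
Proof.
have /clsP := eqv_rel (inv_neg_r Q h_le0); rewrite cls_add cls_tsum.
move=> /(congr1 (wr z)); rewrite wrD cls_comp wrM wr_cls_id => <-.
congr (_ + _); rewrite raddf_sum big_enum; apply: eq_bigr => n _.
by rewrite cls_comp /= wrM dotcupE.
Qed.

Lemma row_inj u (f : mor la (F :: E :: z) u) : f ⊙ rcross la z = 0 ->
  (forall m, (m < natpos (- h))%N -> f ⊙ cupn la z m = 0) -> f = 0.
Proof.
move=> rf cf; rewrite -[f]compf1 -row_sum compDr mcompA rf comp0f add0r.
by rewrite comp_sumr big1 // => n _; rewrite mcompA cf // comp0f.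
Qed.

Lemma row_inj_lw c u (f : mor la (c :: F :: E :: z) u) :
  f ⊙ lw c (rcross la z) = 0 ->
  (forall m, (m < natpos (- h))%N -> f ⊙ lw c (cupn la z m) = 0) -> f = 0.
Proof.
move=> rf cf; rewrite -[f]compf1 -lw_id -row_sum lwD compDr lwM mcompA rf.
rewrite comp0f add0r lw_sum comp_sumr big1 // => n _.
by rewrite lwM mcompA cf // comp0f.
Qed.

End Row.

(** * The zigzags *)

Lemma lw_capn la c z m : lw c (capn la z m) =
  lw c (cap la z) ⊙ mpow m (lw c (dot la (F :: z))).
Proof. by rewrite /capn lwM /dotn lw_mpow. Qed.

Lemma lw_cupn la c z m : lw c (cupn la z m) =
  mpow m (lw c (lw F (dot la z))) ⊙ lw c (cup la z).
Proof. by rewrite /cupn lwM /dotn !lw_mpow. Qed.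

Lemma cupnE la z m : cupn la z m = mpow m (lw F (dot la z)) ⊙ cup la z.
Proof. by rewrite /cupn /dotn lw_mpow. Qed.

Lemma capn0 la z : capn la z 0 = cap la z.
Proof. exact: compf1. Qed.

Lemma cupn0 la z : cupn la z 0 = cup la z.
Proof. by rewrite cupnE; apply: comp1f. Qed.

(* The exponent of the sign between the n-th power of a dot and its mate. *)
Definition mate_sign m := p && odd 'C(m, 2).

Lemma mate_signS m : mate_sign m.+1 = mate_sign m (+) (p && odd m).
Proof.
rewrite /mate_sign binS bin1 oddD.
by case: p => //=; rewrite addbC.
Qed.

Lemma hg_mpow la v (f : mor la v v) m : hg p f -> hg (p && odd m) (mpow m f).
Proof.
move=> hf; elim: m => [|m IH]; first by rewrite andbF; apply: hg_id.
have -> : p && odd m.+1 = p (+) (p && odd m).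
  by rewrite /=; case: p (odd m) => [] [].
exact: hg_comp hf IH.
Qed.

(** Bending reverses the order of the [m] dots, so each of the 'C(m, 2) pairs is exchanged once, at
    the cost of a sign when [p] is odd. *)
Lemma cap_ddotn la z m :
  cap la z ⊙ mpow m (lw E (ddot la z)) = sg (mate_sign m) (capn la z m).
Proof.
elim: m => [|m IH]; first by rewrite /mate_sign andbF capn0; apply: compf1.
rewrite [mpow m.+1 _]/(_ ⊙ mpow m _) mcompA cap_ddot -mcompA -lw_mpow.
rewrite (dotM (hg_mpow m (hg_ddot _ _))) comp_sgr mcompA lw_mpow IH.
rewrite comp_sgl sg_sg mate_signS addbC; congr (sg _ _).
  by case: p (odd m) => [] [].
by rewrite /capn /dotn mpowSr mcompA.
Qed.

Lemma ddotn_cup la z m :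
  mpow m (ddot la (E :: z)) ⊙ cup la z = sg (mate_sign m) (cupn la z m).
Proof.
elim: m => [|m IH]; first by rewrite /mate_sign andbF cupn0; apply: comp1f.
have swap : mpow m (ddot la (E :: z)) ⊙ lw F (dot la z) =
    sg (p && odd m) (lw F (dot la z) ⊙ mpow m (ddot la (E :: z))).
  elim: (m) => [|k IHk]; first by rewrite andbF comp1f; symmetry; apply: compf1.
  rewrite [mpow k.+1 _]/(_ ⊙ mpow k _) -mcompA IHk comp_sgr mcompA.
  rewrite (ddotM (hg_dot _ _)) andbb comp_sgl sg_sg -mcompA.
  by congr (sg _ _); rewrite /=; case: p (odd k) => [] [].
rewrite mpowSr -mcompA ddot_cup mcompA swap comp_sgl -mcompA IH comp_sgr sg_sg.
by rewrite mate_signS addbC cupnE mcompA cupnE.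
Qed.

Lemma dot_dot la z : lw E (dot la z) ⊙ dot la (E :: z) =
  sg p (dot la (E :: z) ⊙ lw E (dot la z)).
Proof. by rewrite (dotM (hg_dot _ _)) sg_sg andbb addbb. Qed.

(** Here [h = k], and [n = k + 1] is the last index at the weight [la + alpha_i], whose pairing is
    [k + 2]. Since [linv] is minus the leftward crossing, [- (lw E (linv la [::]) ⊙ delt n)] is the
    [Y] of the computation; this minus turns the sign [~~ p] into [p]. *)
Lemma zigzagE_pos la k (n : 'I_(natpos (pairing i (tgt la [:: E])))) :
  pairing i (tgt la [::]) = k%:Z -> pairing i (tgt la [:: E]) = k.+2%:Z ->
  n = k.+1 :> nat ->
  lw E (capn la [::] k ⊙ linv la [::]) ⊙ delt n = sg p (idm la [:: E]).
Proof.
move=> h0 h1 n_k.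
have le0 : 0 <= pairing i (tgt la [::]) by rewrite h0.
have le1 : 0 <= pairing i (tgt la [:: E]) by rewrite h1.
have := @zigzag_column la [:: E] [:: E; E; F] [:: E; F; E] [:: F; E; E]
  p false (dot la [::]) (cross la [:: F]) (dot la [:: E; F])
  (lw E (dot la [:: F])) (dot la [:: F; E]) (lw F (cross la [::]))
  (lw E (cap la [::])) (cap la [:: E]) (lw E (rcross la [::]))
  (rcross la [:: E]) k false (idm la [:: E]) (delt n)
  (- (lw E (linv la [::]) ⊙ delt n)).
rewrite -lw_capn addbF addbF.
move=> Z; apply: oppr_inj; rewrite lwM -mcompA.
rewrite -[X in _ = X]/(sg true _) sg_sg addTb -{}Z ?compNr //.
- exact: crossK.
- exact: cap_rcross.
- exact: rcross_braid.
- exact: cross_dotl.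
- by rewrite (dotM (hg_cap _ _)) andbF.
- exact: dot_dot.
- by rewrite (dotM (hg_rcross _ _)) andbb.
- move=> f rf cf; apply: (column_inj_lw le0 rf) => m.
  by rewrite h0 lw_capn; apply: cf.
- move=> f rf cf; apply: (column_inj le1 rf) => m.
  by rewrite h1; apply: cf.
- by rewrite mcompA -lwM (rcross_linv le0) lw_id comp1f.
- move=> m lt_m; rewrite compNr -lw_capn mcompA -lwM (capn_linv le0).
    by rewrite lw0 comp0f oppr0.
  by rewrite h0.
- exact: (rcross_delt le1).
- move=> m lt_m; rewrite (capn_delt le1) ?h1; last exact: ltnW.
  by rewrite n_k ltn_eqF.
- rewrite -[_ ⊙ mpow _ _]/(capn la [:: E] k.+1) (capn_delt le1) ?h1 //.
  by rewrite n_k eqxx.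
Qed.


Lemma zigzagE_neg la k (n : 'I_(natpos (- pairing i (tgt la [::])))) :
  - pairing i (tgt la [::]) = k.+2%:Z -> - pairing i (tgt la [:: E]) = k%:Z ->
  n = k.+1 :> nat ->
  lw E (gamm n) ⊙ (linv la [:: E] ⊙ cupn la [:: E] k) = - idm la [:: E].
Proof.
move=> h0 h1 n_k.
have le0 : pairing i (tgt la [::]) <= 0.
  by rewrite -oppr_ge0 h0.
have le1 : pairing i (tgt la [:: E]) <= 0 by rewrite -oppr_ge0 h1.
(* In a row the dot stands on the other side of the crossing. Solving [cross_dotl] for that
   composite turns the identity into [- sg p] of it, hence the second parameter [~~ p]. *)
have Z := @zigzag_row la [:: E] [:: F; E; E] [:: E; F; E] [:: E; E; F]
  p (~~ p) (dot la [::]) (lw F (cross la [::])) (lw F (lw E (dot la [::])))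
  (lw F (dot la [:: E])) (lw E (lw F (dot la [::]))) (cross la [:: F])
  (cup la [:: E]) (lw E (cup la [::])) (rcross la [:: E])
  (lw E (rcross la [::])) k false (idm la [:: E]) (lw E (gamm n))
  (- (lw E (gamm n) ⊙ linv la [:: E])).
rewrite mcompA; apply: oppr_inj; rewrite opprK -compNl cupnE Z ?compNl //.
- by rewrite addbb.
- by rewrite -lwM crossK lw0.
- exact: rcross_cup.
- by rewrite -rcross_braid.
- rewrite -!lwM cross_dotl lwD lw_sg sgD sg_sg addbb lw_id -addrA /=.
  by case: p; rewrite /= ?addrN ?addNr addr0.
- exact: cupM.
- by rewrite -!lwM dot_dot lw_sg.
- by rewrite (rcrossM (hg_dot _ _)) andbb.
- move=> f rf cf; apply: (row_inj le1 rf) => m.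
  by rewrite h1 cupnE; apply: cf.
- move=> f rf cf; apply: (row_inj_lw le0 rf) => m.
  by rewrite h0 lw_cupn; apply: cf.
- by rewrite -mcompA (linv_rcross le1) compf1.
- move=> m lt_m; rewrite compNl -cupnE -mcompA (linv_cupn le1) ?h1 //.
  by rewrite compf0 oppr0.
- by rewrite -lwM (gamm_rcross le0) lw0.
- move=> m lt_m; rewrite -lw_cupn -lwM (gamm_cupn le0); last first.
    by rewrite h0; apply: ltnW.
  by rewrite n_k eq_sym ltn_eqF ?lw0.
- rewrite -lw_cupn -lwM (gamm_cupn le0) ?h0 //.
  by rewrite n_k eqxx lw_id.
Qed.

(** The pairing changes sign between [la] and [la + alpha_i]: (R5) inverts a row at the first weight
    and a column at the second, each with a single undotted entry besides [sigma]. *)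
Lemma zigzagE_flat la (m : 'I_(natpos (- pairing i (tgt la [::]))))
    (n : 'I_(natpos (pairing i (tgt la [:: E])))) :
  pairing i (tgt la [::]) = -1 -> pairing i (tgt la [:: E]) = 1 ->
  lw E (gamm m) ⊙ delt n = idm la [:: E].
Proof.
move=> h0 h1.
have le0 : pairing i (tgt la [::]) <= 0 by rewrite h0.
have le1 : 0 <= pairing i (tgt la [:: E]) by rewrite h1.
have m0 : m = 0%N :> nat.
  by case: (m) => j; rewrite h0; case: j.
have n0 : n = 0%N :> nat by case: (n) => j; rewrite h1; case: j.
(* Here [sigma] has only a left inverse. The defect is the one cup term of the row identity, and it
   becomes the summand [U g] in [zigzag_flat]. *)
have rl : rcross la [::] ⊙ linv la [::] =
    idm la [:: F; E] - cup la [::] ⊙ gamm m.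
  apply/esym/eqP; rewrite subr_eq; apply/eqP.
  rewrite -(row_sum le0) (bigD1 m) //= m0 cupn0 big1 ?addr0 // => j.
  move/eqP; case; apply: ord_inj; rewrite m0.
  by case: j => j; rewrite /= h0; case: j.
apply: (@zigzag_flat la [:: E] [:: E; E; F] [:: E; F; E] [:: F; E; E]
  (cross la [:: F]) (lw F (cross la [::])) (lw E (cap la [::])) (cap la [:: E])
  (lw E (rcross la [::])) (rcross la [:: E]) (lw E (cup la [::]))
  (cup la [:: E]) _ (delt n) (- (lw E (linv la [::]) ⊙ delt n))).
- exact: crossK.
- exact: cap_rcross.
- exact: rcross_braid.
- by rewrite -lwM crossK lw0.
- move=> f rf; rewrite -[f]comp1f -lw_id -(linv_rcross le0) lwM -mcompA rf.
  exact: compf0.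
- move=> f rf cf; apply: (column_inj le1 rf) => j.
  by rewrite h1; case: j => // _; rewrite capn0.
- exact: zigE.
- exact: rcross_cup.
- have -> : lw E (rcross la [::]) ⊙ - (lw E (linv la [::]) ⊙ delt n) =
      - (lw E (rcross la [::] ⊙ linv la [::]) ⊙ delt n).
    by rewrite compNr mcompA lwM.
  rewrite rl raddfB /= lw_id lwM compDl comp1f compNl opprD opprK.
  by rewrite mcompA.
- exact: (rcross_delt le1).
- by rewrite -[cap _ _]capn0 (capn_delt le1) ?h1 ?n0.
Qed.

Lemma zigzagF_flat la (m : 'I_(natpos (- pairing i (tgt la [:: F]))))
    (n : 'I_(natpos (pairing i (tgt la [::])))) :
  pairing i (tgt la [::]) = 1 -> pairing i (tgt la [:: F]) = -1 ->
  gamm m ⊙ lw F (delt n) = idm la [:: F].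
Proof.
move=> h0 h1.
have le0 : 0 <= pairing i (tgt la [::]) by rewrite h0.
have le1 : pairing i (tgt la [:: F]) <= 0 by rewrite h1.
have m0 : m = 0%N :> nat by case: (m) => j; rewrite h1; case: j.
have n0 : n = 0%N :> nat.
  by case: (n) => j; rewrite h0; case: j.
have rl : rcross la [:: F] ⊙ linv la [:: F] =
    idm la [:: F; E; F] - cup la [:: F] ⊙ gamm m.
  apply/esym/eqP; rewrite subr_eq; apply/eqP.
  rewrite -(row_sum le1) (bigD1 m) //= m0 cupn0 big1 ?addr0 // => j.
  move/eqP; case; apply: ord_inj; rewrite m0.
  by case: j => j; rewrite /= h1; case: j.
apply: (@zigzag_flat la [:: F] [:: E; F; F] [:: F; E; F] [:: F; F; E]
  (lw E (dcross la [::])) (dcross la [:: E]) (cap la [:: F])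
  (lw F (cap la [::]))
  (rcross la [:: F]) (lw F (rcross la [::])) (cup la [:: F])
  (lw F (cup la [::])) _ (lw F (delt n)) (- (linv la [:: F] ⊙ lw F (delt n)))).
- by rewrite -lwM dcrossK lw0.
- exact: cap_rcross_down.
- exact: rcross_braid_down.
- exact: dcrossK.
- move=> f rf; rewrite -[f]comp1f -(linv_rcross le1) -mcompA rf.
  exact: compf0.
- move=> f rf cf; apply: (column_inj_lw le0 rf) => j.
  by rewrite h0; case: j => // _; rewrite capn0.
- exact: zigF.
- exact: rcross_cup_down.
- by rewrite compNr mcompA rl compDl comp1f compNl opprD opprK mcompA.
- by rewrite -lwM (rcross_delt le0) lw0.
- by rewrite -lwM -[cap _ _]capn0 (capn_delt le0) ?h0 ?n0 ?lw_id.
Qed.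

Lemma lw_cap_ddotn la c z m :
  lw c (cap la z) ⊙ mpow m (lw c (lw E (ddot la z))) =
  sg (mate_sign m) (lw c (capn la z m)).
Proof. by rewrite -lw_mpow -lwM cap_ddotn lw_sg. Qed.

Lemma lw_ddotn_cup la c z m :
  mpow m (lw c (ddot la (E :: z))) ⊙ lw c (cup la z) =
  sg (mate_sign m) (lw c (cupn la z m)).
Proof. by rewrite -lw_mpow -lwM ddotn_cup lw_sg. Qed.

(** The words are now (F, EFF, FEF, FFE), and the tests use downward dots. Returning to upward dots
    costs [mate_sign k] in the result and [mate_sign k.+1] in the normalization of [delt n];
    together they give [p && odd k]. *)
Lemma zigzagF_pos la k (n : 'I_(natpos (pairing i (tgt la [::])))) :
  pairing i (tgt la [::]) = k.+2%:Z -> pairing i (tgt la [:: F]) = k%:Z ->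
  n = k.+1 :> nat ->
  (capn la [:: F] k ⊙ linv la [:: F]) ⊙ lw F (delt n) =
  sg (p && odd k) (idm la [:: F]).
Proof.
move=> h0 h1 n_k.
have le0 : 0 <= pairing i (tgt la [::]) by rewrite h0.
have le1 : 0 <= pairing i (tgt la [:: F]) by rewrite h1.
have Z := @zigzag_column la [:: F] [:: E; F; F] [:: F; E; F]
  [:: F; F; E] p p (ddot la [::]) (lw E (dcross la [::]))
  (lw E (lw F (ddot la [::]))) (lw E (ddot la [:: F]))
  (lw F (lw E (ddot la [::]))) (dcross la [:: E]) (cap la [:: F])
  (lw F (cap la [::])) (rcross la [:: F]) (lw F (rcross la [::])) k
  (mate_sign k.+1) (idm la [:: F]) (lw F (delt n))
  (- (linv la [:: F] ⊙ lw F (delt n))).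
apply: oppr_inj; rewrite -mcompA -compNr.
have -> : capn la [:: F] k = sg (mate_sign k)
    (cap la [:: F] ⊙ mpow k (lw E (ddot la [:: F]))).
  by rewrite cap_ddotn sg_sg addbb.
rewrite comp_sgl Z ?compNr //.
- rewrite sg_sg -[RHS]/(sg true _) sg_sg mate_signS; congr (sg _ _).
  by case: p (mate_sign k) (odd k) => [] [] [].
- by rewrite -lwM dcrossK lw0.
- exact: cap_rcross_down.
- exact: rcross_braid_down.
- by rewrite -!lwM dcross_dot lwD !lw_sg lw_id.
- exact: capM.
- by rewrite -!lwM (ddotM (hg_ddot _ _)) andbb lw_sg.
- by rewrite (rcrossM (hg_ddot _ _)) sg_sg andbb addbb.
- move=> f rf cf; apply: (column_inj le1 rf) => m; rewrite h1 => lt_m.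
  by have := cf m lt_m; rewrite cap_ddotn comp_sgl => /sg_eq0.
- move=> f rf cf; apply: (column_inj_lw le0 rf) => m; rewrite h0 => lt_m.
  by have := cf m lt_m; rewrite lw_cap_ddotn comp_sgl => /sg_eq0.
- by rewrite mcompA (rcross_linv le1) comp1f.
- move=> m lt_m; rewrite compNr cap_ddotn comp_sgl mcompA.
  rewrite (capn_linv le1) ?h1 //.
  by rewrite comp0f sg0 oppr0.
- by rewrite -lwM (rcross_delt le0) lw0.
- move=> m lt_m; rewrite lw_cap_ddotn comp_sgl -lwM (capn_delt le0); last first.
    by rewrite h0; apply: ltnW.
  by rewrite n_k ltn_eqF // lw0 sg0.
- rewrite lw_cap_ddotn comp_sgl -lwM (capn_delt le0) ?h0 //.
  by rewrite n_k eqxx lw_id.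
Qed.

Lemma zigzagF_neg la k (n : 'I_(natpos (- pairing i (tgt la [:: F])))) :
  - pairing i (tgt la [::]) = k%:Z -> - pairing i (tgt la [:: F]) = k.+2%:Z ->
  n = k.+1 :> nat ->
  gamm n ⊙ lw F (linv la [::] ⊙ cupn la [::] k) =
  sg (~~ p (+) (p && odd k)) (idm la [:: F]).
Proof.
move=> h0 h1 n_k.
have le0 : pairing i (tgt la [::]) <= 0 by rewrite -oppr_ge0 h0.
have le1 : pairing i (tgt la [:: F]) <= 0 by rewrite -oppr_ge0 h1.
(* Solving [dcross_dot] for [ddot ⊙ dcross] cancels the sign on the identity term and moves that
   term across the equation: the correction is minus the identity, hence [true]. *)
have Z := @zigzag_row la [:: F] [:: F; F; E] [:: F; E; F]
  [:: E; F; F] p true (ddot la [::]) (dcross la [:: E]) (ddot la [:: F; E])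
  (lw F (ddot la [:: E])) (ddot la [:: E; F]) (lw E (dcross la [::]))
  (lw F (cup la [::])) (cup la [:: F]) (lw F (rcross la [::]))
  (rcross la [:: F]) k (mate_sign k.+1) (idm la [:: F]) (gamm n)
  (- (gamm n ⊙ lw F (linv la [::]))).
apply: oppr_inj; rewrite lwM mcompA -compNl.
have -> : lw F (cupn la [::] k) = sg (mate_sign k)
    (mpow k (lw F (ddot la [:: E])) ⊙ lw F (cup la [::])).
  by rewrite lw_ddotn_cup sg_sg addbb.
rewrite comp_sgr Z ?compNl //.
- rewrite sg_sg -[RHS]/(sg true _) sg_sg mate_signS; congr (sg _ _).
  by case: p (mate_sign k) (odd k) => [] [] [].
- exact: dcrossK.
- exact: rcross_cup_down.
- by rewrite -rcross_braid_down.
- rewrite dcross_dot sgD !sg_sg addbb -addrA.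
  by rewrite [X in _ + X](_ : _ = 0) ?addr0 //= addrN.
- by rewrite (ddotM (hg_cup _ _)) andbF.
- by rewrite (ddotM (hg_ddot _ _)) andbb.
- by rewrite (ddotM (hg_rcross _ _)) sg_sg andbb addbb.
- move=> f rf cf; apply: (row_inj_lw le0 rf) => m; rewrite h0 => lt_m.
  by have := cf m lt_m; rewrite lw_ddotn_cup comp_sgr => /sg_eq0.
- move=> f rf cf; apply: (row_inj le1 rf) => m; rewrite h1 => lt_m.
  by have := cf m lt_m; rewrite ddotn_cup comp_sgr => /sg_eq0.
- by rewrite -mcompA -lwM (linv_rcross le0) lw_id compf1.
- move=> m lt_m; rewrite compNl lw_ddotn_cup comp_sgr -mcompA -lwM.
  by rewrite (linv_cupn le0) ?h0 // lw0 compf0 sg0 oppr0.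
- exact: (gamm_rcross le1).
- move=> m lt_m; rewrite ddotn_cup comp_sgr (gamm_cupn le1); last first.
    by rewrite h1; apply: ltnW.
  by rewrite n_k eq_sym ltn_eqF // sg0.
- rewrite ddotn_cup comp_sgr (gamm_cupn le1) ?h1 //.
  by rewrite n_k eqxx.
Qed.

(** * Scalars, shifted weights, and the leftward cups and caps *)

Lemma sclr0 a la v w : scl a (0 : mor la v w) = 0.
Proof. by rewrite -[0]/(pim None) sclE. Qed.

Lemma sclA a b la v w (f : mor la v w) : scl a (scl b f) = scl (a * b) f.
Proof.
elim/morP: f => [f|]; last by rewrite !sclr0.
by rewrite -!cls_scl; apply/clsP/eqv_scaleA.
Qed.

Lemma sclN a la v w (f : mor la v w) : scl (- a) f = - scl a f.
Proof. by rewrite -mulN1r -sclA sclN1. Qed.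

Lemma scl_sg a b la v w (f : mor la v w) : scl a (sg b f) = sg b (scl a f).
Proof.
case: b => //=; apply/eqP; rewrite -addr_eq0; apply/eqP.
elim/morP: f => [f|]; last by rewrite oppr0 sclr0 addr0.
rewrite -sclN1 -!cls_scl -cls_add.
have e := parallel f; rewrite -(cls_zero e); apply/clsP.
apply: eqv_trans (eqv_sym (eqv_scaleDr _ _ _ _)) _.
apply: eqv_trans (eqv_scale a (eqv_addC _ _ _)) _.
by apply: eqv_trans (eqv_scale a (eqv_addN Q e f)) _; apply: eqv_sc0.
Qed.

Lemma comp_scll a la u v w (f : mor la v w) (g : mor la u v) :
  scl a f ⊙ g = scl a (f ⊙ g).
Proof.
elim/morP: f => [f|]; last by rewrite sclr0 !comp0f sclr0.
elim/morP: g => [g|]; last by rewrite !compf0 sclr0.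
by rewrite -cls_scl -!cls_comp -cls_scl; apply/clsP/eqv_vcZl.
Qed.

Lemma comp_sclr a la u v w (f : mor la v w) (g : mor la u v)
  {hf : homogeneous f} : hpart false a -> f ⊙ scl a g = scl a (f ⊙ g).
Proof.
case: hf => q [t ht <-] ha.
elim/morP: g => [g|]; last by rewrite sclr0 !compf0 sclr0.
rewrite -cls_scl -!cls_comp -cls_scl; apply/clsP.
by have := eqv_vcZr Q g ha ht; rewrite expr0 mul1r.
Qed.

Lemma wr_scl a la z v w (f : mor (tgt la z) v w) :
  wr z (scl a f) = scl a (wr z f).
Proof.
elim/morP: f => [f|]; last by rewrite sclr0 !raddf0 sclr0.
by rewrite /wr /idm -cls_scl -!cls_hc -cls_scl; apply/clsP/eqv_hcZl.
Qed.

Lemma lw_scl a la v w c (f : mor la v w) : hpart false a ->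
  lw c (scl a f) = scl a (lw c f).
Proof.
move=> ha; elim/morP: f => [f|]; last by rewrite sclr0 !raddf0 sclr0.
rewrite /lw /wl /idm -cls_scl -!cls_hc -cls_scl; apply/clsP.
have := eqv_hcZr Q f ha (homog_id K (tgt la v) [:: c]).
by rewrite expr0 mul1r.
Qed.

(** Split the inverse as [v0 + v1]. Then [u * v1] is odd, but it equals [1 - u * v0], which is even;
    so it is zero, and [u] can be cancelled. *)
Lemma hpart_unitV (u : K) : hpart false u -> u \is a GRing.unit ->
  hpart false u^-1.
Proof.
move=> hu uu; have [v0 [v1 [h0 h1 uV]]] := hpart_sum u^-1.
suff v10 : v1 = 0 by rewrite uV v10 addr0.
have uv1 : u * v1 = 0.
  apply: hpart_direct; last exact: (hpartM hu h1).
  have -> : u * v1 = 1 - u * v0.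
    by rewrite -(divrr uu) uV mulrDr addrAC subrr add0r.
  exact: hpartB (hpart1 K) (hpartM hu h0).
by rewrite -(mulKr uu v1) uv1 mulr0.
Qed.

Lemma pairing_addw la j : pairing i (addw la j) = pairing i la - d D i j.
Proof.
apply: (@intr_inj (R[i])%C); rewrite -pairingE /= pairingE root_coroot.
by rewrite -intrN -intrD.
Qed.

Lemma pairing_subw la j : pairing i (subw la j) = pairing i la + d D i j.
Proof.
apply: (@intr_inj (R[i])%C); rewrite -pairingE /= pairingE root_coroot.
by rewrite opprK -intrD.
Qed.

Lemma wr_nil la v w (f : mor (tgt la [::]) v w) ev ew :
  castm erefl ev ew (wr [::] f) = f.
Proof.
elim/morP: f => [f|]; last by rewrite raddf0 castm0.
by rewrite /wr /idm -cls_hc castm_cls; apply/clsP/eqv_hc1r.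
Qed.


(** [etal] and [epsl] use the proof carried by [idP] to form an ordinal. Proofs of a boolean are
    unique, so any given proof may replace it. *)
Lemma match_idT (b : bool) T (f : b -> T) (g : ~ b -> T) (hb : b) :
  match @idP b with ReflectT h => f h | ReflectF h => g h end = f hb.
Proof.
by refine (match @idP b as r in reflect _ b' return
    match r with ReflectT h => f h | ReflectF h => g h end = f hb
  with ReflectT h => _ | ReflectF h => _ end); rewrite ?(bool_irrelevance h hb).
Qed.

Lemma match_idF (b : bool) T (f : b -> T) (x : T) : ~~ b ->
  match @idP b with ReflectT h => f h | ReflectF _ => x end = x.
Proof.
move=> /negP nb.
by refine (match @idP b as r in reflect _ b' return
    match r with ReflectT h => f h | ReflectF _ => x end = x
  with ReflectT h => _ | ReflectF h => _ end).
Qed.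

Variable N : km_units Q.

Lemma cls_taul mu : cls (taul i i : tm mu _ _) = - cls (tinv i i).
Proof. by rewrite /taul eqxx cls_scl sclN1. Qed.

(** The minus in the definition of [epsl] cancels the one relating [taul] to [tinv]. In [etal_le0]
    only the latter is present, hence the sign [~~ par_at i mu] there. *)
Lemma epsl_ge0 mu : 0 <= pairing i mu ->
  cls (epsl N i : tm mu _ _) = sg (p && odd `|pairing i mu|)
    (scl (cu N mu i)^-1 (cls (dotcap i `|pairing i mu|) ⊙ cls (tinv i i))).
Proof.
move=> ge0; rewrite /epsl match_idF; last by rewrite oppr_gt0 -leNgt.
rewrite cls_scl cls_comp cls_taul compNr sclN -sclA -[- (_ ⊙ _)]/(sg true _).
by rewrite !scl_sg scl_sgn -[- _]/(sg true _) sg_sg.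
Qed.

Lemma epsl_lt0 mu : pairing i mu < 0 ->
  exists2 n : 'I_(natpos (- pairing i mu)), n.+1 = natpos (- pairing i mu) &
    cls (epsl N i : tm mu _ _) = scl (cu N mu i)^-1 (cls (tgamma n)).
Proof.
rewrite -oppr_gt0 => lt0; exists (Ordinal (natpos_last lt0)).
  by rewrite /= prednK //; case: (- _) lt0 => [[]|].
by rewrite /epsl match_idT cls_scl.
Qed.

Lemma etal_gt0 mu : 0 < pairing i mu ->
  exists2 n : 'I_(natpos (pairing i mu)), n.+1 = natpos (pairing i mu) &
    cls (etal N i : tm mu _ _) = scl (cu N mu i) (cls (tdelta n)).
Proof.
move=> gt0; exists (Ordinal (natpos_last gt0)).
  by rewrite /= prednK //; case: (pairing _ _) gt0 => [[]|].
by rewrite /etal match_idT cls_scl.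
Qed.

Lemma etal_le0 mu : pairing i mu <= 0 ->
  cls (etal N i : tm mu _ _) = sg (~~ par_at i mu)
    (scl (cu N mu i) (cls (tinv i i) ⊙ cls (dotcup i `|pairing i mu|))).
Proof.
move=> le0; rewrite /etal match_idF -?leNgt //.
rewrite cls_scl cls_comp cls_taul compNl -sclA scl_sgn -[- _]/(sg true _).
by rewrite scl_sg sg_sg addbT.
Qed.

Lemma cu_addw la : cu N (addw la i) i = cu N la i.
Proof. by rewrite cu_add tc_diag mul1r. Qed.

(** As [t_ii = 1], the normalizing unit is the same at [la] and at [la + alpha_i], so those of cap
    and cup are mutually inverse; being even, they pass a homogeneous morphism without a sign. *)
Lemma cancelE la b c (f : mor la [:: F; E] [::])
    (g : mor (tgt la [:: E]) [::] [:: E; F]) {hf : homogeneous f} :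
  lw E (sg b (scl (cu N la i)^-1 f)) ⊙
    wr [:: E] (sg c (scl (cu N (addw la i) i) g)) =
  sg (b (+) c) (lw E f ⊙ wr [:: E] g).
Proof.
have hu := cu_even N la i; have uu := cu_unit N la i.
have hV := hpart_unitV hu uu.
rewrite cu_addw lw_sg wr_sg comp_sgl comp_sgr sg_sg wr_scl.
rewrite lw_scl // comp_scll comp_sclr // sclA mulVr //.
by rewrite scl1.
Qed.

Lemma cancelF la b c (f : mor (tgt la [:: F]) [:: F; E] [::])
    (g : mor la [::] [:: E; F]) {hf : homogeneous f} :
  wr [:: F] (sg b (scl (cu N (subw la i) i)^-1 f)) ⊙
    lw F (sg c (scl (cu N la i) g)) =
  sg (b (+) c) (wr [:: F] f ⊙ lw F g).
Proof.
have hu := cu_even N la i; have uu := cu_unit N la i.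
rewrite -[in (cu N (subw la i) i)^-1]cu_addw subwK lw_sg wr_sg comp_sgl.
rewrite comp_sgr sg_sg wr_scl lw_scl // comp_scll comp_sclr // sclA mulVr //.
by rewrite scl1.
Qed.

Lemma capn_nil la m : capn la [::] m = cls (dotcap i m).
Proof. by rewrite -dotcapE; apply: (wr_nil _ erefl erefl). Qed.

Lemma cupn_nil la m : cupn la [::] m = cls (dotcup i m).
Proof. by rewrite -dotcupE; apply: (wr_nil _ erefl erefl). Qed.

Lemma linv_nil la : linv la [::] = cls (tinv i i).
Proof. exact: (wr_nil _ erefl erefl). Qed.

Lemma delt_nil la n : @delt la [::] n = cls (tdelta n).
Proof. exact: (wr_nil _ erefl erefl). Qed.

Lemma gamm_nil la n : @gamm la [::] n = cls (tgamma n).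
Proof. exact: (wr_nil _ erefl erefl). Qed.

Lemma scl_sg_false la v w a (f : mor la v w) : scl a f = sg false (scl a f).
Proof. by []. Qed.

Lemma zigzagE_left la :
  lw E (cls (epsl N i)) ⊙ wr [:: E] (cls (etal N i)) =
  sg (par_at i la) (idm la [:: E]).
Proof.
have hE : pairing i (addw la i) = pairing i la + 2.
  by rewrite pairing_addw d_diag.
(* The constructors of [int] match the three regimes: [Posz k] is [h >= 0], [Negz 0] is [h = -1],
   and [Negz k.+1] is [h = - (k + 2)]. *)
rewrite /par_at; case h0: (pairing i la) hE => [k|[|k]] hE.
- have {}hE : pairing i (addw la i) = k.+2%:Z by rewrite hE; lia.
  have [|n nE ->] := @etal_gt0 (addw la i); first by rewrite hE.
  rewrite epsl_ge0 ?h0 // [scl (cu N (addw _ _) _) _]scl_sg_false.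
  rewrite cancelE addbF /=.
  rewrite -capn_nil -linv_nil (@zigzagE_pos la k n) //; last first.
    by apply: succn_inj; rewrite nE hE.
  rewrite sg_sg; congr (sg _ _).
  have -> : odd `|(k%:Z + 1)%R|%N = ~~ odd k by lia.
  by case: p (odd k) => [] [].
- have {}hE : pairing i (addw la i) = 1 by rewrite hE.
  have [|m mE ->] := @epsl_lt0 la; first by rewrite h0.
  have [|n nE ->] := @etal_gt0 (addw la i); first by rewrite hE.
  rewrite [scl (cu N la _)^-1 _]scl_sg_false.
  rewrite [scl (cu N (addw _ _) _) _]scl_sg_false cancelE.
  by rewrite -gamm_nil [LHS](@zigzagE_flat la m n) ?andbF.
- have {}hE : pairing i (addw la i) = - k%:Z by rewrite hE; lia.
  have [|n nE ->] := @epsl_lt0 la; first by rewrite h0.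
  rewrite etal_le0; last by rewrite hE oppr_le0.
  rewrite [scl (cu N la _)^-1 _]scl_sg_false cancelE -gamm_nil wrM dotcupE.
  rewrite hE abszN absz_nat (@zigzagE_neg la k n); first last.
  + by apply: succn_inj; rewrite nE h0.
  + by rewrite [pairing _ _]hE opprK.
  + by rewrite [pairing _ _]h0.
  (* [etal] brings the sign [~~ par_at] at [la + alpha_i], and [zigzagE_neg] a minus. What remains
     is [par_at] at [la], since the two pairings differ by 2. *)
  rewrite /par_at hE -[- idm _ _]/(sg true _) sg_sg; congr (sg _ _).
  have -> : odd `|(Negz k.+1 + 1)%R|%N = odd `|(- k%:Z + 1)%R|%N by lia.
  by rewrite /= addbT negbK.
Qed.

Lemma zigzagF_left la :
  wr [:: F] (cls (epsl N i)) ⊙ lw F (cls (etal N i)) = idm la [:: F].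
Proof.
have hF : pairing i (subw la i) = pairing i la - 2.
  by rewrite pairing_subw d_diag.
have [le0|] := lerP (pairing i la) 0.
  have [k h0] : exists k : nat, pairing i la = - k%:Z.
    by exists `|pairing i la|%N; lia.
  have {}hF : pairing i (subw la i) = - k.+2%:Z by rewrite hF h0; lia.
  have [|n nE ->] := @epsl_lt0 (subw la i); first by rewrite hF.
  rewrite etal_le0 // [scl (cu N (subw _ _) _)^-1 _]scl_sg_false cancelF.
  rewrite -linv_nil h0 abszN absz_nat -cupn_nil.
  rewrite [X in sg _ X](@zigzagF_neg la k n); first last.
  + by apply: succn_inj; rewrite nE hF opprK.
  + by rewrite [pairing _ _]hF opprK.
  + by rewrite [pairing _ _]h0 opprK.
  (* The sign [~~ par_at] of [etal] is the negation of [p && ~~ odd k]; it cancels the sign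
     [~~ p (+) (p && odd k)] from [zigzagF_neg]. *)
  rewrite sg_sg /par_at h0.
  have -> : odd `|(- k%:Z + 1)%R|%N = ~~ odd k by lia.
  by case: p (odd k) => [] [].
(* The positive values split into [h = 1], where the pairing is -1 at [la - alpha_i] and no dots
   occur, and [h = k + 2]. *)
case h0: (pairing i la) hF => [[|[|k]]|k] // hF _.
- have {}hF : pairing i (subw la i) = -1 by rewrite hF.
  have [|m mE ->] := @epsl_lt0 (subw la i); first by rewrite hF.
  have [|n nE ->] := @etal_gt0 la; first by rewrite h0.
  rewrite [scl (cu N la _) _]scl_sg_false.
  rewrite [scl (cu N (subw _ _) _)^-1 _]scl_sg_false cancelF.
  by rewrite -delt_nil [LHS](@zigzagF_flat la m n).
- have {}hF : pairing i (subw la i) = k%:Z by rewrite hF; lia.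
  have [|n nE ->] := @etal_gt0 la; first by rewrite h0.
  rewrite epsl_ge0 ?hF // [scl (cu N la _) _]scl_sg_false cancelF addbF /=.
  rewrite wrM dotcapE -delt_nil (@zigzagF_pos la k n) //; last first.
    by apply: succn_inj; rewrite nE h0.
  by rewrite sg_sg addbb.
Qed.


End Generators.
End Calculus.

Theorem proposition6p2 (K : superRing) (R : realType) (I : eqType)
    (D : cartan_datum R I) (Q : km_params K D) (N : km_units Q)
    (i : I) (la : weight D) :
  eqv Q (la := la)
    ((tid [:: E i] ⊗ epsl N i) ∘ (etal N i ⊗ tid [:: E i]))%tm
    ((-1) ^+ par_at i la *: tid [:: E i])%tm
  /\
  eqv Q (la := la)
    ((epsl N i ⊗ tid [:: F i]) ∘ (tid [:: F i] ⊗ etal N i))%tm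
    (tid [:: F i]).
Proof.
split; apply/clsP.
  rewrite cls_scl scl_sgn -[RHS](zigzagE_left i N) cls_comp.
  congr (mcomp _ _); first exact: (cls_hc Q (tid [:: E i]) (epsl N i)).
  exact: (cls_hc Q (etal N i) (tid [:: E i])).
rewrite -[RHS](zigzagF_left i N) cls_comp.
congr (mcomp _ _); first exact: (cls_hc Q (epsl N i) (tid [:: F i])).
exact: (cls_hc Q (tid [:: F i]) (etal N i)).
Qed.
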